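(* Let $n\ge k\ge 2$ be integers, let $P$ be a $(k-1)$-dimensional polytope and let $p\in P$. Let $F(P)$ denote the set of non-empty proper faces of $P$. Assume that for every $\tau\in F(P)$ we are given $n$ points $y_\tau^1,\dots,y_\tau^n\in \tau$, and that we are given closed sets $(A^i_\tau \mid i\in [n],\ \tau\in F(P))$ of $P$ forming a $k$-weakly Komiya cover of $P$, i.e. for every $I\subseteq[n]$ with $|I|=n-k+1$ and every face $\sigma$ of $P$ we have $\sigma\subseteq \bigcup_{\tau\in F(P),\,\tau\subseteq\sigma}\ \bigcup_{j\in I}A^j_\tau$. Then there exist an injection $\pi:[k]\to[n]$ and faces $\tau_1,\dots,\tau_k\in F(P)$ such that $p\in \mathrm{conv}\{y^{\pi(1)}_{\tau_1},\dots,y^{\pi(k)}_{\tau_k}\}$ and $\bigcap_{i=1}^k A^{\pi(i)}_{\tau_i}\neq\emptyset$.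
   Context: A family $(A_\tau\mid \tau\in F(P))$ of subsets of $P$ is a Komiya cover of $P$ if $\sigma\subseteq\bigcup_{\tau\subseteq\sigma}A_\tau$ for every face $\sigma$ of $P$ (including $\sigma=P$). For $n\ge k,m$, a family of closed sets $(A^i_\sigma\mid i\in[n],\sigma\in F(P))$ is an $m$-weakly Komiya cover of $P$ if for every $I\in\binom{[n]}{n-m+1}$ the family $(\bigcup_{j\in I}A^j_\sigma\mid\sigma\in F(P))$ is a Komiya cover of $P$. *)

(* Defs.v *)
From HB Require Import structures.
From mathcomp Require Import all_boot all_order all_algebra.
From mathcomp Require Import all_classical all_reals all_analysis.
Set Implicit Arguments. Unset Strict Implicit. Unset Printing Implicit Defensive.
Import Order.TTheory GRing.Theory Num.Theory.
Import numFieldTopology.Exports.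
Local Open Scope classical_set_scope.
Local Open Scope ring_scope.

Definition in_conv (R : realType) (d m : nat) (x : 'I_m -> 'rV[R]_d)
    (p : 'rV[R]_d) : Prop :=
  exists lam : 'I_m -> R,
    (forall i, 0 <= lam i) /\ \sum_(i < m) lam i = 1 /\
    p = \sum_(i < m) lam i *: x i.

Definition is_polytope (R : realType) (d : nat) (P : set 'rV[R]_d) : Prop :=
  exists (m : nat) (v : 'I_m -> 'rV[R]_d), P = [set p | in_conv v p].

Definition aff_indep (R : realType) (d m : nat) (x : 'I_m -> 'rV[R]_d) : Prop :=
  forall lam : 'I_m -> R,
    \sum_(i < m) lam i = 0 -> \sum_(i < m) lam i *: x i = 0 ->
    forall i, lam i = 0.

Definition aff_dim_eq (R : realType) (d : nat) (S : set 'rV[R]_d) (e : nat) : Prop :=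
  (exists x : 'I_e.+1 -> 'rV[R]_d, (forall i, S (x i)) /\ aff_indep x) /\
  ~ (exists x : 'I_e.+2 -> 'rV[R]_d, (forall i, S (x i)) /\ aff_indep x).

Definition dotv (R : realType) (d : nat) (a x : 'rV[R]_d) : R :=
  \sum_(j < d) a ord0 j * x ord0 j.

(* F is a face of P: intersection of P with a supporting hyperplane
   (a = 0, b = 0 gives P itself; the empty set is also a face) *)
Definition is_face (R : realType) (d : nat) (P F : set 'rV[R]_d) : Prop :=
  exists (a : 'rV[R]_d) (b : R),
    (forall x, P x -> dotv a x <= b) /\
    F = [set x | P x /\ dotv a x = b].

Definition FP (R : realType) (d : nat) (P F : set 'rV[R]_d) : Prop :=
  is_face P F /\ F !=set0 /\ F <> P.

(* Main.v *)
(* Fix barycentric coordinates in which [P] contains the standard simplex, and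
   let [r] be the nearest-point projection onto [P]. Each point [v] of a fine grid
   in a large simplex around [P] receives all labels [(tau, i)] such that [tau] lies
   in the face of [P] exposed by [v - r v] and [r v] lies in [A i tau]; the
   covering hypothesis provides labels of at least [k] different colours [i].
   Scarf's primitive sets of the grid, completed by slack vertices, form a mod 2
   cycle. Rainbow label sets have no homology in low dimensions, so this cycle is
   carried to a chain of rainbow label sets, except near slack vertices. The number
   of simplices of a cycle that contain a generic point close to [p] is even, and
   the slack vertices alone account for one such simplex, so there is another one;
   the choice of the projection prevents it from touching a slack vertex. Refining
   the grid and moving the generic point to [p] concludes by compactness. *)
From HB Require Import structures.
From mathcomp Require Import all_boot all_order all_algebra zify ring lra.
From mathcomp Require boolp.
Set Implicit Arguments. Unset Strict Implicit. Unset Printing Implicit Defensive.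
Import Order.TTheory GRing.Theory Num.Theory.

(** * Scarf's primitive sets *)

(** Primitive sets stand in for a triangulation of the grid: they need only the [k.+1] linear orders
    of the vertices, one per coordinate, and their incidences are settled by comparing row minima.
    One label per vertex would leave the colours free to repeat. Keeping all labels turns the image
    of a vertex into a whole complex, so sets of vertices are sent to chains, and colours become
    distinct because cycles are filled with rainbow simplices. The obstacle is the slack vertices,
    whose labels are artificial. The target is therefore not [p] but [p + c] with [c] positive in
    every coordinate, which opens a gap that labels near a slack vertex cannot bridge. The order of
    choices matters: the generic [c] fixes the gap, and only then is the mesh made small against it.
    In the sections below [k] is the dimension, one less than the number of colours sought. *)

Section Scarf.
Variables (W : finType) (k : nat) (f : 'I_k.+1 -> W -> nat).
Hypothesis f_inj : forall i, injective (f i).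

(** Equivalently, no vertex exceeds the minimum over [sg] in all rows at once. With [k.+1] elements
    these are Scarf's primitive sets. *)
Definition dominating (sg : {set W}) : bool :=
  [forall w, exists i, forall x in sg, (f i w <= f i x)%N].

Lemma dominatingP (sg : {set W}) :
  reflect (forall w, exists i, forall x, x \in sg -> (f i w <= f i x)%N)
          (dominating sg).
Proof.
apply: (iffP forallP) => [h w|h w].
  by have /existsP[i /forall_inP hi] := h w; exists i.
by have [i hi] := h w; apply/existsP; exists i; apply/forall_inP.
Qed.

Lemma dominating_sub (sg tau : {set W}) :
  tau \subset sg -> dominating sg -> dominating tau.
Proof.
move=> /subsetP st /dominatingP h; apply/dominatingP => w.
by have [i hi] := h w; exists i => x /st; apply: hi.
Qed.

(** When [g j] is the minimum of row [j] over a set, these are the vertices whose addition keeps the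
    minimum of every row other than [c]. *)
Definition above (g : 'I_k.+1 -> W) (c : 'I_k.+1) : {set W} :=
  [set z | [forall j, (j != c) ==> (f j (g j) < f j z)%N]].

Lemma aboveP g c z :
  reflect (forall j, j != c -> (f j (g j) < f j z)%N) (z \in above g c).
Proof.
rewrite inE; apply: (iffP forallP) => [h j jc|h j].
  by have := h j; rewrite jc.
by apply/implyP => jc; apply: h.
Qed.

Lemma min_index (tau : {set W}) i : tau != set0 ->
  exists2 x, x \in tau & forall y, y \in tau -> (f i x <= f i y)%N.
Proof.
by case/set0Pn => x0 x0t; case: (arg_minnP (f i) x0t) => x xt h; exists x.
Qed.

(* A set of [k] elements has [k.+1] row minima, so exactly one element is the
   minimum for two rows [a], [b]; an added element must take over one of these
   two rows, and is then the largest candidate for that row. *)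
Lemma dominating_extensions (tau : {set W}) :
  (0 < k)%N -> #|tau| = k -> dominating tau ->
  exists g : 'I_k.+1 -> W, exists a b : 'I_k.+1,
  [/\ a != b, g a = g b,
      forall i, g i \in tau /\ (forall y, y \in tau -> (f i (g i) <= f i y)%N),
      (forall y, y \in tau -> exists i, g i = y)
    & (forall i j, g i = g j -> i != j -> [set i; j] = [set a; b]) /\
      forall z, ((z \notin tau) && dominating (z |: tau)) <->
        exists2 c, c \in [set a; b] & z \in above g c /\
           (forall z', z' \in above g c -> (f c z' <= f c z)%N)].
Proof.
move=> k0 ct dt; have t0 : tau != set0 by rewrite -card_gt0 ct.
have [g gP] : exists g : 'I_k.+1 -> W, forall i, g i \in tau /\
    (forall y, y \in tau -> (f i (g i) <= f i y)%N).
  have h i : {x | (x \in tau) && [forall y in tau, (f i x <= f i y)%N]}.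
    apply/sigW; have [x xt hx] := min_index i t0; exists x; rewrite xt /=.
    by apply/forall_inP.
  exists (fun i => sval (h i)) => i; case: (h i) => x /= /andP[xt /forall_inP hx].
  by split.
have gsurj y : y \in tau -> exists i, g i = y.
  move=> yt; have /dominatingP/(_ y)[i hi] := dt; exists i; apply: (@f_inj i).
  by apply/eqP; rewrite eqn_leq (gP i).2 // hi // (gP i).1.
have imgg : g @: [set: 'I_k.+1] = tau.
  apply/setP => y; apply/imsetP/idP => [[i _ ->]|/gsurj[i <-]]; first exact: (gP i).1.
  by exists i.
have [a [b [ab gab]]] : exists a b, a != b /\ g a = g b.
  have : ~~ [forall a, forall b, (g a == g b) ==> (a == b)].
    apply/negP => /forallP h.
    have gi : injective g.
      by move=> i j /eqP gij; have /forallP/(_ j) := h i; rewrite gij => /eqP.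
    by have := card_imset [set: 'I_k.+1] gi; rewrite imgg ct cardsT card_ord; lia.
  rewrite negb_forall => /existsP[a]; rewrite negb_forall => /existsP[b].
  by rewrite negb_imply => /andP[/eqP gab ab]; exists a, b.
have surjD c c' : c != c' -> g c = g c' -> {in [set~ c] &, injective g}.
  move=> cc gcc;
  apply/imset_injP; rewrite cardsC1 card_ord /=.
  suff -> : g @: [set~ c] = tau by rewrite ct.
  rewrite -imgg; apply/setP => y; apply/imsetP/imsetP.
    by case=> i _ ->; exists i.
  case=> i _ ->; have [->|ic] := eqVneq i c; last by exists i; rewrite // !inE.
  by exists c'; rewrite // !inE eq_sym.
have uniq2 i j : g i = g j -> i != j -> [set i; j] = [set a; b].
  move=> gij ij.
  have ha : a \in [set i; j].
    rewrite !inE; apply/negPn/negP; rewrite negb_or => /andP[ai aj].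
    have := surjD a b ab gab i j; rewrite !inE eq_sym ai eq_sym aj.
    by move=> /(_ isT isT gij) e; rewrite e eqxx in ij.
  have hb : b \in [set i; j].
    rewrite !inE; apply/negPn/negP; rewrite negb_or => /andP[ai aj].
    have ba : b != a by rewrite eq_sym.
    have := surjD b a ba (esym gab) i j; rewrite !inE eq_sym ai eq_sym aj.
    by move=> /(_ isT isT gij) e; rewrite e eqxx in ij.
  apply/eqP; rewrite eq_sym eqEcard !cards2 ij ab leqnn andbT.
  by apply/subsetP => x; rewrite in_set2 => /orP[]/eqP->.
exists g, a, b; split => //; split => // z; split.
  case/andP => zt /dominatingP dz.
  have [i0 hi0] := dz z.
  have hlt : (f i0 z < f i0 (g i0))%N.
    rewrite ltn_neqAle hi0 ?inE ?(gP i0).1 ?orbT // andbT.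
    by apply: contra zt => /eqP/f_inj ->; rewrite (gP i0).1.
  (* [J] collects the rows whose old minimum survives the addition of [z]. Each element of [tau]
     keeps such a row, so [J] has at least [k] elements and misses only the row [i0] that [z] takes
     over. *)
  pose J := [set i | (f i (g i) < f i z)%N].
  have gJ : g @: J = tau.
    apply/setP => y; apply/imsetP/idP => [[i _ ->]|yt]; first exact: (gP i).1.
    have [i hi] := dz y; exists i.
      rewrite inE; have e : g i = y.
        apply: (@f_inj i); apply/eqP.
        by rewrite eqn_leq (gP i).2 // hi // !inE (gP i).1 orbT.
      rewrite e ltn_neqAle hi ?inE ?eqxx // andbT.
      by apply: contra zt => /eqP/f_inj <-.
    apply: (@f_inj i); apply/eqP.
    by rewrite eqn_leq (gP i).2 // hi // !inE (gP i).1 orbT.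
  have i0J : i0 \notin J by rewrite inE -leqNgt ltnW.
  have JE : J = [set~ i0].
    apply/eqP; have := leq_imset_card g (mem J); rewrite gJ ct => kJ.
    rewrite eqEcard cardsC1 card_ord kJ andbT.
    by apply/subsetP => i iJ; rewrite !inE; apply: contraNneq i0J => <-.
  have [i iJ gi] : exists2 i, i \in J & g i0 = g i.
    by apply/imsetP; rewrite gJ (gP i0).1.
  exists i0.
    rewrite -(uniq2 i0 i) ?inE ?eqxx //.
    by move: iJ; rewrite JE !inE eq_sym.
  split.
    apply/aboveP => j ji; have : j \in J by rewrite JE !inE.
    by rewrite inE.
  move=> z' /aboveP hz'; rewrite leqNgt; apply/negP => zz'.
  have [i' hi'] := dz z'.
  have [e|ne] := eqVneq i' i0.
    by have := hi' z; rewrite !inE eqxx => /(_ isT); rewrite e leqNgt zz'.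
  by have := hi' (g i'); rewrite !inE (gP i').1 orbT leqNgt hz' // => /(_ isT).
case=> c cab [/aboveP zc zmax].
have [c' c'c gc] : exists2 c', c' != c & g c' = g c.
  by move: cab; rewrite !inE => /orP[]/eqP->; [exists b; rewrite // eq_sym|exists a].
have zt : z \notin tau.
  apply/negP => /gsurj[j e].
  have [jc|jc] := eqVneq j c.
    by have := zc c' c'c; rewrite gc -jc e ltnn.
  by have := zc j jc; rewrite e ltnn.
rewrite zt; apply/dominatingP => w.
have /dominatingP dt' := dt.
have hz x : x \in tau -> (f c z <= f c x)%N.
  have [i hi] := dt' z; have [<-|ic] := eqVneq i c; first exact: hi.
  by have := hi (g i) (gP i).1; rewrite leqNgt zc.
have [/aboveP wc|] := boolP (w \in above g c).
  exists c => x; rewrite !inE => /orP[/eqP->|/hz]; first by apply: zmax; apply/aboveP.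
  by apply: leq_trans; apply: zmax; apply/aboveP.
rewrite inE negb_forall => /existsP[i]; rewrite negb_imply -leqNgt => /andP[ic wi].
exists i => x; rewrite !inE => /orP[/eqP->|/((gP i).2)]; last exact: leq_trans.
by rewrite (leq_trans wi) // ltnW // zc.
Qed.

Variable s : 'I_k.+1 -> W.
Hypothesis s_inj : injective s.
Hypothesis s_low : forall i w, (f i (s i) <= f i w)%N.
Hypothesis s_high : forall i j w, i != j -> w \notin codom s -> (f i w < f i (s j))%N.

Definition slacks : {set W} := s @: [set: 'I_k.+1].

Lemma slack_codom x : (x \in slacks) = (x \in codom s).
Proof. by apply/imsetP/codomP => [[i _ ->]|[i ->]]; exists i. Qed.

Lemma slacks_not_dominating : (exists w, w \notin slacks) -> ~~ dominating slacks.
Proof.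
case=> w ws; apply/negP => /dominatingP/(_ w)[i hi].
have := hi (s i) (imset_f s (in_setT i)).
rewrite leqNgt ltn_neqAle s_low andbT; case: eqP => // /f_inj e.
by rewrite -e /slacks imset_f in ws.
Qed.

(** Each of the two rows that share a minimum offers one extension, namely its largest candidate,
    and the two candidate sets are disjoint. A row can run out of candidates only if [tau] consists
    of slacks; then exactly one row does, and [slacks], which is not dominating, is counted by hand
    as the missing extension. *)
Lemma room_parity (tau : {set W}) :
  (0 < k)%N -> #|tau| = k -> (exists w, w \notin slacks) ->
  (exists za zb, za != zb /\ forall z,
    ((z \notin tau) && (dominating (z |: tau) || (z |: tau == slacks))) =
      ((z == za) || (z == zb))) \/
  (forall z, ((z \notin tau) && (dominating (z |: tau) || (z |: tau == slacks))) = false).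
Proof.
move=> k0 ct ws; have cs : #|slacks| = k.+1 by rewrite card_imset // cardsT card_ord.
have [dt|dt] := boolP (dominating tau); last first.
  right=> z; apply/negP => /andP[zt /orP[h|/eqP h]].
    by rewrite (dominating_sub _ h) ?subsetUr in dt.
  have ts : tau \subset slacks by rewrite -h subsetUr.
  have /imsetP[c _ zc] : z \in slacks by rewrite -h !inE eqxx.
  case/negP: dt; apply/dominatingP => w.
  have [/imsetP[i _ ->]|wS] := boolP (w \in slacks); first by exists i => x _; apply: s_low.
  exists c => x xt; have /imsetP[j _ xj] := subsetP ts x xt; rewrite xj ltnW // s_high //.
    by apply: contraNneq zt; rewrite zc => ->; rewrite -xj.
  by rewrite -slack_codom.
have [g [a [b [ab gab gP gsurj [uniq2 ext]]]]] := dominating_extensions k0 ct dt.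
left.
have amax c : above g c != set0 -> exists2 z, z \in above g c &
    forall z', z' \in above g c -> (f c z' <= f c z)%N.
  by case/set0Pn => z0 z0t; case: (arg_maxnP (f c) z0t) => x xt h; exists x.
have aU c x y : x \in above g c -> y \in above g c ->
  (forall z', z' \in above g c -> (f c z' <= f c x)%N) ->
  (forall z', z' \in above g c -> (f c z' <= f c y)%N) -> x = y.
  move=> xa ya hx hy; apply: (@f_inj c); apply/eqP.
  by rewrite eqn_leq hx // hy.
have disj c c' x : c != c' -> x \in above g c -> x \in above g c' -> False.
  move=> cc /aboveP xc /aboveP xc'; have /dominatingP/(_ x)[i hi] := dt.
  have := hi _ (gP i).1; rewrite leqNgt.
  have [ic|ic] := eqVneq i c; last by rewrite xc.
  by rewrite xc' // ic.
have [ts|ts] := boolP (tau \subset slacks); last first.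
  have /subsetPn[w0 w0t w0s] := ts.
  have ne c : above g c != set0.
    apply/set0Pn; exists (s c); apply/aboveP => j jc.
    rewrite (leq_ltn_trans ((gP j).2 _ w0t)) // s_high //.
    by rewrite -slack_codom.
  have [za zaA zam] := amax a (ne a); have [zb zbB zbm] := amax b (ne b).
  exists za, zb; split; first by apply/eqP => e; rewrite e in zaA; apply: (disj a b zb).
  move=> z; have -> : (z |: tau == slacks) = false.
    by apply/eqP => h; rewrite -h subsetUr in ts.
  rewrite orbF; apply/idP/idP => [/ext[c]|h].
    rewrite in_set2 => /orP[]/eqP-> [h1 h2].
      by have -> : z = za by [exact: (aU a z za h1 zaA h2 zam)]; rewrite eqxx.
    by have -> : z = zb by [exact: (aU b z zb h1 zbB h2 zbm)]; rewrite eqxx orbT.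
  apply/ext; case/orP: h => /eqP ->; first by exists a; rewrite ?in_set2 ?eqxx.
  by exists b; rewrite ?in_set2 ?eqxx ?orbT.
have [c ctau] : exists c, s c \notin tau.
  have /subsetPn[x /imsetP[c _ ->] h] : ~~ (slacks \subset tau).
    by apply/negP => /subset_leq_card; rewrite cs ct ltnn.
  by exists c.
have tE : tau = slacks :\ s c.
  apply/eqP; rewrite eqEcard ct [X in (X <= _)%N](_ : _ = k); last first.
    have scS : s c \in slacks by apply: imset_f.
    by have := cardsD1 (s c) slacks; rewrite cs scS add1n => -[<-].
  rewrite leqnn andbT; apply/subsetP => x xt; rewrite !inE (subsetP ts) // andbT.
  by apply: contraNneq ctau => <-.
have sjt j : j != c -> s j \in tau by move=> jc; rewrite tE !inE /slacks imset_f // andbT inj_eq.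
have gs j : j != c -> g j = s j.
  by move=> jc; apply: (@f_inj j); apply/eqP; rewrite eqn_leq s_low (gP j).2 // sjt.
have [d dc gc] : exists2 d, d != c & g c = s d.
  have /subsetP/(_ _ (gP c).1)/imsetP[d _ e] := ts; exists d => //.
  by apply: contraNneq ctau => <-; rewrite -e (gP c).1.
have cd : [set c; d] = [set a; b].
  by apply: uniq2; rewrite ?gc ?gs // eq_sym.
have [w wS] := ws.
have wA : w \in above g c.
  apply/aboveP => j jc; rewrite gs // ltn_neqAle s_low andbT.
  by apply: contraNneq wS => /f_inj <-; rewrite /slacks imset_f.
have [zc zcA zcm] : exists2 z, z \in above g c &
    forall z', z' \in above g c -> (f c z' <= f c z)%N.
  by apply: amax; apply/set0Pn; exists w.
(* A member would exceed [s d] in row [c], which no vertex outside the slacks does. Among the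
   slacks, [s c] is lowest in row [c], and any [s j] with [j] different from [c] and [d] is itself
   the minimum of row [j]. *)
have dE : above g d = set0.
  apply/setP => z; rewrite [RHS]inE; apply/negP => /aboveP hz.
  have := hz c; rewrite eq_sym dc gc => /(_ isT); apply/negP; rewrite -leqNgt.
  have [/imsetP[j _ zj]|zS] := boolP (z \in slacks); last first.
    by rewrite ltnW // s_high // -?slack_codom // eq_sym.
  rewrite zj; have [->|jc] := eqVneq j c; first exact: s_low.
  have [->//|jd] := eqVneq j d.
  by have := hz j jd; rewrite zj gs // ltnn.
exists zc, (s c); split.
  apply: contraNneq wS => zs; have := zcm w wA; rewrite zs => h.
  have /f_inj -> : f c w = f c (s c) by apply/eqP; rewrite eqn_leq h s_low.
  by rewrite /slacks imset_f.
move=> z; apply/idP/idP => [/andP[zt /orP[h|/eqP h]]|/orP[]/eqP->].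
- have zd : (z \notin tau) && dominating (z |: tau) by rewrite zt.
  have [e] := (ext z).1 zd.
  rewrite -cd in_set2 => /orP[]/eqP-> [h1 h2].
    by have -> : z = zc by [exact: (aU c z zc h1 zcA h2 zcm)]; rewrite eqxx.
  by rewrite dE in_set0 in h1.
- apply/orP; right; have : z \in slacks by rewrite -h !inE eqxx.
  by apply: contraTT => zc'; rewrite tE !inE zc' in zt.
- have /andP[h1 h2] : (zc \notin tau) && dominating (zc |: tau).
    by apply/ext; exists c; rewrite // -cd in_set2 eqxx.
  by rewrite h1 h2.
- by rewrite ctau tE setD1K ?eqxx ?orbT // /slacks imset_f.
Qed.
End Scarf.

(** * Mod 2 chains and rainbow fillings *)

Section Chains.
Variable L : finType.
Local Open Scope ring_scope.

(* Mod 2 chains of the full simplex on [L], augmented: the empty set is the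
   only simplex of dimension -1. *)
Definition chain := {ffun {set L} -> 'F_2}.
Implicit Types (z w : chain) (a b : L) (s t U : {set L}).

Definition bd z : chain := [ffun t : {set L} => \sum_(x | x \notin t) z (x |: t)].
Definition cone a z : chain := [ffun t : {set L} => if a \in t then z (t :\ a) else 0].
(** The cofactor of [b]: a chain is its part avoiding [b] plus [cone b (link b z)]. *)
Definition link b z : chain := [ffun t : {set L} => if b \in t then 0 else z (b |: t)].

Lemma F2_addrr (x : 'F_2) : x + x = 0.
Proof. by apply: (@addrr_pchar2 'F_2); apply: pchar_Fp. Qed.

Lemma chain_addrr z : z + z = 0.
Proof. by apply/ffunP => t; rewrite !ffunE F2_addrr. Qed.

Lemma bdD z w : bd (z + w) = bd z + bd w.
Proof.
apply/ffunP => t; rewrite !ffunE -big_split /=.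
by apply: eq_bigr => x _; rewrite ffunE.
Qed.

Lemma bd0 : bd 0 = 0.
Proof. by apply/ffunP => t; rewrite !ffunE big1 // => x _; rewrite ffunE. Qed.

Lemma bd_sum (I : finType) (P : pred I) (F : I -> chain) :
  bd (\sum_(i | P i) F i) = \sum_(i | P i) bd (F i).
Proof. exact: (big_morph bd bdD bd0). Qed.

Lemma cone0 a : cone a 0 = 0.
Proof. by apply/ffunP => t; rewrite !ffunE; case: ifP. Qed.

(** The contraction of a full simplex onto [a]; [cone a] kills the simplices that already contain
    [a], and the augmentation makes the identity hold in every degree. *)
Lemma cone_homotopy a z : bd (cone a z) = z + cone a (bd z).
Proof.
apply/ffunP => t; rewrite !ffunE; have [at_|at_] := boolP (a \in t); last first.
  rewrite (bigD1 a) //= big1 ?addr0 => [|x /andP[_ xa]].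
    by rewrite ffunE !inE eqxx setU1K.
  by rewrite ffunE !inE eq_sym (negPf xa) (negPf at_).
rewrite (bigD1 a (P := fun x => x \notin t :\ a)) /=; last by rewrite !inE eqxx.
rewrite setD1K // addrA F2_addrr add0r; apply: eq_big => [x|x xt].
  by rewrite !inE negb_and negbK andb_orl andbN /=; case: eqVneq => [->|//]; rewrite ?at_ ?andbT.
have xa : x != a by apply: contraNneq xt => ->.
rewrite ffunE !inE at_ orbT; congr (z _); apply/setP => y; rewrite !inE.
by case: (eqVneq y x) => [->|]; rewrite ?xa ?andbT.
Qed.

Lemma bd_link b z : bd (link b z) = link b (bd z).
Proof.
apply/ffunP => t; rewrite !ffunE; have [bt|bt] := boolP (b \in t).
  by rewrite big1 // => x _; rewrite ffunE !inE bt orbT.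
rewrite (bigD1 b) //= ffunE !inE eqxx /= add0r; apply: eq_big => [x|x /andP[xt xb]].
  by rewrite !inE negb_or andbC.
by rewrite ffunE !inE (negPf bt) eq_sym (negPf xb) orbF setUCA.
Qed.

Definition carried (Q : {set L} -> Prop) z := forall s, z s != 0 -> Q s.

Lemma carriedD Q z w : carried Q z -> carried Q w -> carried Q (z + w).
Proof.
move=> hz hw s; rewrite ffunE; have [->|/hz//] := eqVneq (z s) 0.
by rewrite add0r => /hw.
Qed.

Lemma carried_sum Q (I : finType) (P : pred I) (F : I -> chain) :
  (forall i, P i -> carried Q (F i)) -> carried Q (\sum_(i | P i) F i).
Proof.
move=> h; elim/big_ind : _ => //; first by move=> s; rewrite ffunE eqxx.
by move=> *; apply: carriedD.
Qed.

Lemma bd_cone_cycle a z : bd z = 0 -> bd (cone a z) = z.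
Proof. by move=> h; rewrite cone_homotopy h cone0 addr0. Qed.

Variables (C : finType) (col : L -> C).

Definition rainbow s := {in s &, injective col}.

Definition rainbow_in m U s := [/\ #|s| = m, s \subset U & rainbow s].

Lemma rainbow_cone a m U U' z : a \in U -> U' \subset U ->
  (forall x, x \in U' -> col x != col a) ->
  carried (rainbow_in m U') z -> carried (rainbow_in m.+1 U) (cone a z).
Proof.
move=> aU UU ha hz s; rewrite ffunE; case: ifP => [as_|_]; last by rewrite eqxx.
move=> /hz[cs /subsetP sU rs]; split.
- by rewrite (cardsD1 a) as_ cs.
- apply/subsetP => x xs; have [->//|xa] := eqVneq x a.
  by apply: (subsetP UU); apply: sU; rewrite !inE xa.
- move=> x y xs ys e; have [xa|xa] := eqVneq x a; have [ya|ya] := eqVneq y a.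
  + by rewrite xa ya.
  + have /ha : y \in U' by apply: sU; rewrite !inE ya.
    by rewrite -e xa eqxx.
  + have /ha : x \in U' by apply: sU; rewrite !inE xa.
    by rewrite e ya eqxx.
  + by apply: rs; rewrite // !inE ?xa ?ya.
Qed.

(* Rainbow subsets of [U] form a join of discrete sets, whose reduced homology
   vanishes below the top dimension. The naive filling [cone a z] contains
   non-rainbow simplices [a, b, ...] with [col b = col a], which are corrected by
   the boundaries of [cone a (cone b (w b))], [w b] being a filling of [link b z]. *)
Lemma rainbow_filling m U z :
  (m < #|col @: U|)%N -> carried (rainbow_in m U) z -> bd z = 0 ->
  exists2 w, carried (rainbow_in m.+1 U) w & bd w = z.
Proof.
elim: m U z => [|m IH] U z cU hz bz.
  have [a aU] : exists a, a \in U.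
    by move: cU; rewrite card_gt0 => /set0Pn[_ /imsetP[a aU _]]; exists a.
  exists (cone a z); last exact: bd_cone_cycle.
  apply: (rainbow_cone aU (sub0set U)) => [x|s /hz[cs _ rs]]; first by rewrite inE.
  by split=> //; move/eqP: cs; rewrite cards_eq0 => /eqP ->; rewrite sub0set.
have [a aU] : exists a, a \in U.
  have /card_gt0P[_ /imsetP[a aU _]] := leq_ltn_trans (leq0n _) cU.
  by exists a.
pose U' := [set x in U | col x != col a].
have U'U : U' \subset U by apply/subsetP => x; rewrite inE => /andP[].
have cU' : (m < #|col @: U'|)%N.
  rewrite -ltnS; apply: leq_trans cU _.
  have /subset_leq_card : col @: U \subset col a |: col @: U'.
    apply/subsetP => _ /imsetP[x xU ->]; rewrite !inE.
    have [//|/= xa] := eqVneq (col x) (col a).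
    by rewrite imset_f // inE xU.
  move=> h; apply: leq_trans h _.
  by rewrite cardsU1; case: (_ \notin _); rewrite ?add1n ?add0n.
pose B b := [&& b \in U, b != a & col b == col a].
have [w wP] : exists w : L -> chain, forall b, B b ->
    carried (rainbow_in m.+1 U') (w b) /\ bd (w b) = link b z.
  apply: (fin_all_exists (P := fun b w =>
    B b -> carried (rainbow_in m.+1 U') w /\ bd w = link b z)).
  move=> b; have [/and3P[bU ba /eqP cba]|_] := boolP (B b); last by exists 0.
  have [||w w1 w2] := IH U' (link b z) cU'; last by exists w.
    move=> s; rewrite ffunE; case: ifPn => [|bs]; first by rewrite eqxx.
    move=> /hz[cs /subsetP sU rs]; split.
    - by move: cs; rewrite cardsU1 bs add1n => -[].
    - apply/subsetP => x xs; rewrite inE sU ?inE ?xs ?orbT //=.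
      rewrite -cba; apply: contraNneq bs => e.
      by rewrite -(rs x b) // !inE ?xs ?eqxx ?orbT.
    - by move=> x y xs ys; apply: rs; rewrite !inE ?xs ?ys orbT.
  by rewrite bd_link bz; apply/ffunP => t; rewrite !ffunE; case: ifP.
(* The sum removes exactly the bad simplices of [cone a z]: a rainbow simplex of [z] that avoids [a]
   contains at most one [b] of the colour of [a]. *)
pose R := cone a z + \sum_(b | B b) cone a (cone b (link b z)).
(* For each [b], the three added cones make up the boundary of [cone a (cone b (w b))], so the
   boundary of [cone a z] is unchanged. The last two cones are rainbow because [w b] lives in [U'],
   away from the colour of [a] and [b]. *)
exists (R + \sum_(b | B b) (cone b (w b) + cone a (w b))); last first.
  rewrite !bdD bd_cone_cycle // !bd_sum -addrA -big_split /= big1 ?addr0 // => b Bb.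
  have [_ bw] := wP b Bb.
  have bl : bd (link b z) = 0.
    by rewrite bd_link bz; apply/ffunP => t; rewrite !ffunE; case: ifP.
  rewrite bdD !cone_homotopy !bw bl !cone0 !addr0.
  by rewrite [w b + _ + _]addrACA chain_addrr add0r chain_addrr.
apply: carriedD; last first.
  apply: carried_sum => b Bb; have /and3P[bU ba /eqP cba] := Bb.
  have [hw _] := wP b Bb.
  by apply: carriedD; apply: rainbow_cone hw => // x; rewrite inE ?cba => /andP[].
move=> s; rewrite /R !ffunE; case: ifPn => [as_|ans]; last first.
  rewrite add0r sum_ffunE big1 ?eqxx // => b _.
  by rewrite !ffunE (negPf ans).
rewrite sum_ffunE.
have -> : \sum_(b | B b) cone a (cone b (link b z)) s = \sum_(b | B b && (b \in s)) z (s :\ a).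
  rewrite [RHS]big_mkcondr; apply: eq_bigr => b /and3P[bU ba cba].
  rewrite !ffunE as_ !inE ba /=; case: ifP => // bs.
  by rewrite eqxx setD1K // !inE ba bs.
have [->|zs] := eqVneq (z (s :\ a)) 0; first by rewrite big1 ?addr0 ?eqxx.
have [cs /subsetP sU rs] := hz _ zs.
case: (pickP (fun b => B b && (b \in s))) => [b /andP[Bb bs]|nb].
  have /and3P[bU ba /eqP cba] := Bb.
  rewrite (bigD1 b) ?Bb //= big1 ?addr0 ?F2_addrr ?eqxx // => b'.
  move=> /andP[/andP[/and3P[b'U b'a /eqP cb'a] b's] b'b].
  by case/eqP: b'b; apply: rs; rewrite ?inE ?ba ?b'a ?bs // cba.
move=> _; have sU' : s :\ a \subset U'.
  apply/subsetP => x xs; rewrite inE sU //=; apply/eqP => e.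
  by have := nb x; rewrite /B sU // e eqxx; move: xs; rewrite !inE => /andP[-> ->].
suff : carried (rainbow_in m.+2 U) (cone a [ffun t : {set L} => (t == s :\ a)%:R]).
  by apply; rewrite !ffunE as_ eqxx oner_eq0.
apply: (rainbow_cone (U' := U')) => // [x|t]; first by rewrite inE => /andP[].
by rewrite ffunE; case: (t =P s :\ a) => [-> _|]; rewrite ?eqxx.
Qed.

End Chains.

(** * Acyclic carriers: from sets of vertices to chains of labels *)

Section ChainMap.
Variables (W L C : finType) (col : L -> C) (c : W -> {set L}) (slack : {set W}).
Variable k : nat.
Hypothesis c_neq0 : forall w, c w != set0.
Hypothesis c_col : forall w, w \notin slack -> (k < #|col @: c w|)%N.
Local Open Scope ring_scope.

(** The rainbow clause is restricted to sets without slacks because a slack vertex may have too few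
    colours for rainbow fillings to exist. *)
Definition carrier (sg : {set W}) (s : {set L}) :=
  [/\ #|s| = #|sg|, s \subset \bigcup_(w in sg) c w &
     [disjoint sg & slack] -> rainbow col s].

(** Two elements can be removed in either order, and the two equal terms cancel. This is the
    vanishing of the double boundary on the side of [W]. *)
Lemma sum_pairs_F2 (V : nmodType) (sg : {set W}) (F : {set W} -> V) :
  (forall x : V, x + x = 0) ->
  \sum_(v in sg) \sum_(u in sg :\ v) F (sg :\ v :\ u) = 0.
Proof.
move=> V2.
pose lt (u v : W) := (enum_rank u < enum_rank v)%N.
have ltN u v : u != v -> lt u v = ~~ lt v u.
  move=> uv; rewrite /lt -leqNgt ltn_neqAle.
  by case: eqP => // /val_inj/enum_rank_inj e; rewrite e eqxx in uv.
pose G v u := F (sg :\ v :\ u).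
have Gs u v : G u v = G v u.
  by rewrite /G; congr F; apply/setP => x; rewrite !inE andbCA.
have -> : \sum_(v in sg) \sum_(u in sg :\ v) F (sg :\ v :\ u) =
   \sum_(v in sg) \sum_(u in sg | lt u v) G v u +
   \sum_(v in sg) \sum_(u in sg | lt v u) G v u.
  rewrite -big_split; apply: eq_bigr => v vs /=.
  rewrite (bigID (fun u => lt u v)) /=; congr (_ + _); apply: eq_bigl => u; rewrite !inE.
    by have [->|uv] := eqVneq u v; rewrite /= /lt ?ltnn ?andbF.
  have [->|uv] := eqVneq u v; first by rewrite /= /lt ltnn andbF.
  by rewrite (ltN v u) 1?eq_sym.
rewrite [X in _ + X](exchange_big_dep (fun u => u \in sg)) /=; last by move=> ? ? _ /andP[].
rewrite [X in _ + X](_ : _ = \sum_(v in sg) \sum_(u in sg | lt u v) G v u) ?V2 //.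
apply: eq_bigr => v vs; apply: eq_big => [u|u _]; last exact: Gs.
by rewrite vs.
Qed.

(** Induction on cardinality: the images of the facets of [sg] add up to a cycle, which has to be
    filled. Without slacks a single vertex of [sg] already supplies more than [k] colours, enough
    for a rainbow filling up to cardinality [k.+1]; otherwise a plain cone from any available label
    does. *)
Lemma carrier_chain_map : exists phi : {set W} -> chain L,
  phi set0 = [ffun s : {set L} => (s == set0)%:R] /\
  forall sg : {set W}, (#|sg| <= k.+1)%N ->
    carried (carrier sg) (phi sg) /\ bd (phi sg) = \sum_(v in sg) phi (sg :\ v).
Proof.
suff : forall m, (m <= k.+1)%N -> exists phi : {set W} -> chain L,
  phi set0 = [ffun s : {set L} => (s == set0)%:R] /\
  forall sg : {set W}, (#|sg| <= m)%N ->
    carried (carrier sg) (phi sg) /\ bd (phi sg) = \sum_(v in sg) phi (sg :\ v).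
  by apply.
elim=> [_|m IH mk].
  exists (fun=> [ffun s : {set L} => (s == set0)%:R]); split => // sg.
  rewrite leqn0 cards_eq0 => /eqP->; split.
    move=> s; rewrite ffunE; case: (s =P set0) => [-> _|]; last by rewrite eqxx.
    by split; rewrite ?cards0 ?sub0set // => _ x y; rewrite inE.
  rewrite big_set0; apply/ffunP => t; rewrite !ffunE big1 // => x _; rewrite ffunE.
  by case: (_ =P set0) => // /setP/(_ x); rewrite !inE eqxx.
have [phi [phi0 phiP]] := IH (ltnW mk).
have [psi psiP] : exists psi : {set W} -> chain L, forall sg : {set W}, #|sg| = m.+1 ->
    carried (carrier sg) (psi sg) /\ bd (psi sg) = \sum_(v in sg) phi (sg :\ v).
  apply: (fin_all_exists (P := fun (sg : {set W}) w => #|sg| = m.+1 -> carried (carrier sg) w /\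
      bd w = \sum_(v in sg) phi (sg :\ v))) => sg.
  have [/eqP csg|/eqP ?] := boolP (#|sg| == m.+1); last by exists 0.
  have cD v : v \in sg -> #|sg :\ v| = m.
    by move=> vs; have := cardsD1 v sg; rewrite vs csg add1n => -[].
  set z := \sum_(v in sg) phi (sg :\ v).
  have zP : carried (fun s => [/\ #|s| = m, s \subset \bigcup_(w in sg) c w &
     [disjoint sg & slack] -> rainbow col s]) z.
    apply: carried_sum => v vs s sn0.
    have [|h _] := phiP (sg :\ v); first by rewrite cD.
    have [h1 h2 h3] := h s sn0; split; first by rewrite h1 cD.
      apply: subset_trans h2 _; apply/bigcupsP => w ws; apply: bigcup_sup.
      by move: ws; rewrite !inE => /andP[].
    by move=> d; apply: h3; apply: disjointWl d; apply: subsetDl.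
  have bz : bd z = 0.
    rewrite bd_sum -[RHS](@sum_pairs_F2 _ sg phi (@chain_addrr L)).
    apply: eq_bigr => v vs; have [|_ ->//] := phiP (sg :\ v).
    by rewrite cD.
  have [v vs] : exists v, v \in sg by apply/card_gt0P; rewrite csg.
  have [dis|ndis] := boolP [disjoint sg & slack].
    have [|||w w1 w2] := @rainbow_filling L C col m (\bigcup_(w in sg) c w) z; last 1 first.
    - exists w => _; split => // s /w1[? ? ?]; split => //; by rewrite csg.
    - have vS : v \notin slack by rewrite (disjointFr dis).
      apply: leq_trans mk _; apply: leq_trans (c_col vS) _.
      by apply: subset_leq_card; apply: imsetS; apply: bigcup_sup.
    - by move=> s /zP[? ? /(_ dis)].
    - by [].
  have /set0Pn[a ac] := c_neq0 v.
  have aU : a \in \bigcup_(w in sg) c w by apply/bigcupP; exists v.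
  exists (cone a z) => _; split; last exact: bd_cone_cycle.
  move=> s; rewrite ffunE; case: ifP => [as_|]; last by rewrite eqxx.
  move=> /zP[h1 h2 _]; split; last by rewrite (negPf ndis).
    by rewrite csg (cardsD1 a) as_ h1.
  by rewrite -(setD1K as_) subUset sub1set aU.
exists (fun sg : {set W} => if #|sg| == m.+1 then psi sg else phi sg); split.
  by rewrite cards0.
move=> sg sm.
have E v : v \in sg ->
    (if #|sg :\ v| == m.+1 then psi (sg :\ v) else phi (sg :\ v)) = phi (sg :\ v).
  move=> vs; have := cardsD1 v sg; rewrite vs add1n => e.
  by case: eqP => // ?; lia.
rewrite (eq_bigr _ E); case: eqP => [/psiP//|ne]; apply: phiP.
by lia.
Qed.

End ChainMap.

(** * Crossing numbers of generic points *)

Lemma coefficient_sum (R : realFieldType) (L : finType) (k : nat)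
    (u : L -> 'rV[R]_k) (lam : L -> R) (x : 'rV[R]_k) :
  (forall l, \sum_j u l 0 j = 1)%R -> (\sum_l lam l *: u l = x)%R ->
  (\sum_l lam l = \sum_j x 0 j)%R.
Proof.
move=> u1 <-; under [RHS]eq_bigr do rewrite summxE.
rewrite exchange_big /=; apply: eq_bigr => l _.
by under eq_bigr do rewrite mxE; rewrite -mulr_sumr u1 mulr1.
Qed.

Section ConeCocycle.
Variables (R : realFieldType) (L : finType) (k : nat) (u : L -> 'rV[R]_k.+1).
Variable p : 'rV[R]_k.+1.
Local Open Scope ring_scope.

(** Conic rather than convex combinations, because the target used later, [p + c], lies off the
    hyperplane of coordinate sum one that holds the labels. *)
Definition in_cone (s : {set L}) := exists lam : L -> R,
  [/\ forall l, (0 <= lam l)%R, forall l, l \notin s -> lam l = 0%R &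
      \sum_l lam l *: u l = p].

Definition generic := forall lam : L -> R, \sum_l lam l *: u l = p ->
  (k.+1 <= #|[set l | lam l != 0%R]|)%N.

Hypothesis u_sum1 : forall l, \sum_j u l 0 j = 1.
Hypothesis p_generic : generic.

Lemma generic_full (s : {set L}) (lam : L -> R) : #|s| = k.+1 ->
  (forall l, l \notin s -> lam l = 0) -> \sum_l lam l *: u l = p ->
  forall l, l \in s -> lam l != 0.
Proof.
move=> cs ls /p_generic hp l lS; apply/eqP => l0; move: hp; apply/negP.
rewrite -ltnNge -cs; apply: proper_card; apply/properP; split.
  by apply/subsetP => x; rewrite inE; apply: contraNT => /ls ->.
by exists l; rewrite // inE l0 eqxx.
Qed.

Lemma generic_free (s : {set L}) (lam nu : L -> R) : #|s| = k.+1 ->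
  (forall l, l \notin s -> lam l = 0) -> \sum_l lam l *: u l = p ->
  (forall l, l \notin s -> nu l = 0) -> \sum_l nu l *: u l = 0 ->
  forall l, nu l = 0.
Proof.
move=> cs ls lp ns np l; have [lS|/ns//] := boolP (l \in s).
apply/eqP; apply: contraT => nl.
pose lam' x := lam x - lam l / nu l * nu x.
have : lam' l != 0.
  apply: (generic_full cs) => // [x xs|]; first by rewrite /lam' (ls x) ?(ns x) ?mulr0 ?subr0.
  transitivity (\sum_x lam x *: u x - (lam l / nu l) *: \sum_x nu x *: u x).
    rewrite scaler_sumr -sumrB; apply: eq_bigr => x _.
    by rewrite scalerBl scalerA.
  by rewrite np lp scaler0 subr0.
by rewrite /lam' divfK // subrr eqxx.
Qed.

Lemma affine_relation (T : {set L}) : #|T| = k.+2 ->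
  exists nu : L -> R, [/\ forall l, l \notin T -> nu l = 0,
    \sum_l nu l *: u l = 0 & exists x, nu x != 0].
Proof.
move=> cT; pose M := \matrix_(i < #|T|) u (enum_val i).
have rM : (\rank M < #|T|)%N by apply: leq_ltn_trans (rank_leq_col M) _; rewrite cT.
have kn0 : kermx M != 0.
  by rewrite -mxrank_eq0 mxrank_ker subn_eq0 -ltnNge.
have /rowV0Pn[v /sub_kermxP vM vn0] := kn0.
pose nu l := \sum_(i < #|T| | enum_val i == l) v 0 i.
have nuE i : nu (enum_val i) = v 0 i.
  rewrite /nu (bigD1 i) //= big1 ?addr0 // => j /andP[/eqP/enum_val_inj -> ].
  by rewrite eqxx.
exists nu; split.
- move=> l lT; rewrite /nu big1 // => i /eqP e.
  by rewrite -e enum_valP in lT.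
- rewrite -[RHS]vM mulmx_sum_row /nu.
  under eq_bigr do rewrite scaler_suml.
  rewrite (exchange_big_dep predT) //=; apply: eq_bigr => i _.
  rewrite (bigD1 (enum_val i)) //= big1 ?addr0 ?rowK // => l /andP[/eqP <-].
  by rewrite eqxx.
- have /existsP[i vi] : [exists i, v 0 i != 0].
    apply: contraNT vn0; rewrite negb_exists => /forallP h; apply/eqP/rowP => i.
    by rewrite mxE; apply/eqP; have := h i; rewrite negbK.
  by exists (enum_val i); rewrite nuE.
Qed.

(* The representations of [p] on [T] form a line [lam + t nu]; by genericity
   its nonnegative part is a segment each of whose two end points lies on a
   single facet. *)
Lemma cone_facets (T : {set L}) : #|T| = k.+2 ->
  (forall x, x \in T -> ~ in_cone (T :\ x)) \/
  exists x y, [/\ x \in T, y \in T, x != y &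
     forall z, z \in T -> in_cone (T :\ z) <-> z = x \/ z = y].
Proof.
move=> cT.
have [nu0 [nu0T nu0R [x0 nu0x]]] := affine_relation cT.
have cD x : x \in T -> #|T :\ x| = k.+1.
  by move=> xT; have := cardsD1 x T; rewrite xT cT add1n => -[].
have offD x (lam : L -> R) : (forall l, l \notin T :\ x -> lam l = 0) ->
    (forall l, l \notin T -> lam l = 0) /\ lam x = 0.
  move=> h; split=> [l lT|]; apply: h; rewrite !inE ?eqxx //.
  by rewrite (negPf lT) andbF.
suff main x : x \in T -> in_cone (T :\ x) -> exists y,
    [/\ x \in T, y \in T, x != y &
     forall z, z \in T -> in_cone (T :\ z) <-> z = x \/ z = y].
  have [h|h] : (exists x, x \in T /\ in_cone (T :\ x)) \/ ~ (exists x, x \in T /\ in_cone (T :\ x)).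
    exact: boolp.EM.
    by have [x [xT xc]] := h; right; exists x; apply: main.
  by left => x xT xc; apply: h; exists x.
move=> xT xc; have [lam [lam0 lamD lamp]] := xc.
have [lamT lamx] := offD _ _ lamD.
have nux0 : nu0 x != 0.
  apply: contra nu0x => /eqP nx; rewrite (generic_free (cD x xT) lamD lamp _ nu0R) //.
  by move=> l; rewrite !inE negb_and negbK => /orP[/eqP->|/nu0T].
pose nu l := nu0 l / nu0 x.
have nux : nu x = 1 by rewrite /nu divff.
have nuT l : l \notin T -> nu l = 0 by move=> /nu0T; rewrite /nu => ->; rewrite mul0r.
have nuR : \sum_l nu l *: u l = 0.
  transitivity ((nu0 x)^-1 *: \sum_l nu0 l *: u l); last by rewrite nu0R scaler0.
  by rewrite scaler_sumr; apply: eq_bigr => l _; rewrite scalerA mulrC.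
(* Since [nu x = 1], a zero total forces a negative coefficient, so the ray [lam + t nu] has to
   leave the nonnegative orthant. *)
have nuS : \sum_l nu l = 0.
  by rewrite (coefficient_sum u_sum1 nuR) big1 // => j _; rewrite mxE.
have [l0 l0N] : exists l, nu l < 0.
  have /existsP[l ?] : [exists l, nu l < 0]; last by exists l.
  apply: contraT; rewrite negb_exists => /forallP h.
  have : 1 <= \sum_l nu l.
    rewrite (bigD1 x) //= nux lerDl sumr_ge0 // => l _.
    by have := h l; rewrite -leNgt.
  by rewrite nuS ler10.
(* The time at which coordinate [l] vanishes along the ray; the first coordinate to vanish, [y],
   gives the second facet. *)
pose t l := lam l / - nu l.
case: (@arg_minP _ R L l0 (fun l => nu l < 0) t l0N) => y yN ymin.
have yT : y \in T by apply: contraLR yN => /nuT ->; rewrite ltxx.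
have xy : x != y by apply: contraTneq yN => <-; rewrite nux ltr10.
exists y; split => // z zT; split=> [zc|[->//|->]]; last first.
  exists (fun l => lam l + t y * nu l); split.
  - move=> l; have t0 : 0 <= t y by rewrite divr_ge0 // oppr_ge0 ltW.
    have [n0|n0] := leP 0 (nu l); first by rewrite addr_ge0 // mulr_ge0.
    have := ymin l n0; rewrite /t ler_pdivlMr ?oppr_gt0 // mulrN.
    by rewrite -subr_ge0 opprK.
  - move=> l; rewrite !inE negb_and negbK => /orP[/eqP->|lT].
      by rewrite /t invrN mulrN mulNr divfK ?lt_eqF // subrr.
    by rewrite lamT // nuT // mulr0 addr0.
  - transitivity (\sum_l lam l *: u l + t y *: \sum_l nu l *: u l).
      rewrite scaler_sumr -big_split; apply: eq_bigr => l _.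
      by rewrite scalerDl scalerA.
    by rewrite nuR lamp scaler0 addr0.
have [->|zx] := eqVneq z x; first by left.
right; have [lam2 [lam20 lam2D lam2p]] := zc.
have [lam2T lam2z] := offD _ _ lam2D.
(* By genericity the labels of [T :\ x] are independent, so [lam2] is the point of the line at time
   [lam2 x]. Coordinate [z] vanishes there; were [z] not [y], coordinate [y] would still be
   positive, although it is the first to vanish. *)
have e l : lam2 l = lam l + lam2 x * nu l.
  apply/eqP; rewrite -subr_eq0 opprD addrA; apply/eqP.
  apply: (generic_free (cD x xT) lamD lamp (nu := fun l => lam2 l - lam l - lam2 x * nu l)).
    move=> j; rewrite !inE negb_and negbK => /orP[/eqP->|jT].
      by rewrite lamx nux mulr1 subr0 subrr.
    by rewrite lam2T // lamT // nuT // mulr0 !subr0.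
  transitivity (\sum_l lam2 l *: u l - \sum_l lam l *: u l - lam2 x *: \sum_l nu l *: u l).
    rewrite scaler_sumr -!sumrB; apply: eq_bigr => j _.
    by rewrite !scalerBl scalerA.
  by rewrite lam2p lamp nuR scaler0 subr0 subrr.
have lz : 0 < lam z.
  by rewrite lt_def lam0 (generic_full (cD x xT) lamD lamp) // !inE zx.
have l2x : 0 < lam2 x.
  by rewrite lt_def lam20 (generic_full (cD z zT) lam2D lam2p) // !inE eq_sym zx.
apply/eqP; apply: contraT => zy.
have l2y : 0 < lam2 y.
  by rewrite lt_def lam20 (generic_full (cD z zT) lam2D lam2p) // !inE eq_sym zy.
have nz : nu z < 0.
  have := e z; rewrite lam2z => h; rewrite ltNge; apply/negP => n0.
  by have := ltr_pwDl lz (mulr_ge0 (lam20 x) n0); rewrite -h ltxx.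
have := ymin z nz; rewrite /t.
have -> : lam z / - nu z = lam2 x.
  apply: (mulIf (x := - nu z)); rewrite ?oppr_eq0 ?lt_eqF // divfK ?oppr_eq0 ?lt_eqF //.
  by have := e z; rewrite lam2z => h; rewrite mulrN; apply/eqP; rewrite -subr_eq0 opprK -h.
rewrite ler_pdivrMr ?oppr_gt0 // mulrN => h.
by move: l2y; rewrite e -ltrBlDr sub0r ltNge h.
Qed.

End ConeCocycle.

(** * A rainbow Scarf lemma *)

Section RainbowScarf.
Variables (W L C : finType) (k : nat).
Variables (f : 'I_k.+1 -> W -> nat) (s : 'I_k.+1 -> W).
Variables (c : W -> {set L}) (q : 'I_k.+1 -> L) (col : L -> C) (D : pred {set L}).
Hypothesis k_gt0 : (0 < k)%N.
Hypothesis f_inj : forall i, injective (f i).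
Hypothesis s_inj : injective s.
Hypothesis s_low : forall i w, (f i (s i) <= f i w)%N.
Hypothesis s_high : forall i j w, i != j -> w \notin codom s -> (f i w < f i (s j))%N.
Hypothesis nonslack : exists w, w \notin slacks s.
Hypothesis q_inj : injective q.
Hypothesis c_slack : forall i, c (s i) = [set q i].
Hypothesis c_col : forall w, w \notin slacks s -> (k < #|col @: c w|)%N.
Hypothesis D_facets : forall T : {set L}, #|T| = k.+2 ->
  (forall x, x \in T -> ~~ D (T :\ x)) \/
  exists x y, [/\ x \in T, y \in T, x != y &
     forall z, z \in T -> D (T :\ z) = (z == x) || (z == y)].
Hypothesis D_slack : D (q @: [set: 'I_k.+1]).
Local Open Scope ring_scope.

(** [D t] will mean that the cone over [t] contains the generic point, which makes this a crossing
    number mod 2. [D_facets] says that it is a cocycle, hence zero on boundaries. *)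
Definition degree (z : chain L) : 'F_2 := \sum_(t | D t) z t.

Lemma degree_sum (I : finType) (P : pred I) (F : I -> chain L) :
  degree (\sum_(i | P i) F i) = \sum_(i | P i) degree (F i).
Proof.
rewrite /degree exchange_big /=; apply: eq_bigr => t _.
by rewrite sum_ffunE.
Qed.

Lemma degree_bd (w : chain L) :
  carried (fun t : {set L} => #|t| = k.+2) w -> degree (bd w) = 0.
Proof.
move=> hw.
have -> : degree (bd w) = \sum_x \sum_(t : {set L} | (x \in t) && D (t :\ x)) w t.
  rewrite /degree; under eq_bigr do rewrite ffunE.
  rewrite (exchange_big_dep predT) //=; apply: eq_bigr => x _.
  rewrite (reindex_onto (fun t : {set L} => t :\ x) (fun t : {set L} => x |: t)) /=; last first.
    by move=> t /andP[_ xt]; rewrite setU1K.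
  apply: eq_big => [t|t /andP[/andP[_ _] /eqP->//]].
  rewrite !inE eqxx /= andbT andbC; case: (boolP (x \in t)) => xt.
    by rewrite setD1K // eqxx.
  by apply/negbTE/negP => /andP[/eqP e _]; rewrite -e !inE eqxx in xt.
rewrite (exchange_big_dep predT) //= big1 // => T _.
have [->|wT] := eqVneq (w T) 0; first by rewrite big1.
have [h|[x [y [xT yT xy h]]]] := D_facets (hw _ wT).
  by rewrite big_pred0 // => x; apply/negP => /andP[xT]; apply/negP/h.
rewrite (bigD1 x) /=; last by rewrite xT h ?eqxx.
rewrite (bigD1 y) /=; last by rewrite yT h ?eqxx ?orbT //= eq_sym.
rewrite big_pred0 ?addr0 ?F2_addrr // => z.
apply/negP => /andP[/andP[/andP[zT]]]; rewrite h // => /orP[]/eqP->; rewrite ?eqxx //.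
Qed.

(** Slack vertices carry one label each, so [q @: A] is the only simplex the carrier allows.
    Comparing boundary coefficients at [q @: (A :\ i)] reduces [A] to [A :\ i], down to the
    augmentation. *)
Lemma chain_map_slack (phi : {set W} -> chain L) :
  phi set0 = [ffun t : {set L} => (t == set0)%:R] ->
  (forall sg : {set W}, (#|sg| <= k.+1)%N ->
    carried (carrier col c (slacks s) sg) (phi sg) /\
    bd (phi sg) = \sum_(v in sg) phi (sg :\ v)) ->
  forall A : {set 'I_k.+1}, phi (s @: A) (q @: A) = 1.
Proof.
move=> phi0 phiP A; have [m] := ubnP #|A|; elim: m A => // m IH A; rewrite ltnS => cA.
have [->|] := eqVneq A set0; first by rewrite !imset0 phi0 ffunE eqxx.
case/set0Pn => i iA.
have sD j : j \in A -> s @: A :\ s j = s @: (A :\ j).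
  move=> jA; apply/setP => x; rewrite !inE; apply/andP/imsetP => [[xj /imsetP[l lA xl]]|[l]].
    by exists l; rewrite // !inE lA andbT; apply: contraNneq xj => <-; rewrite xl.
  by rewrite !inE => /andP[lj lA] ->; rewrite inj_eq // lj imset_f.
have sub (B : {set 'I_k.+1}) (t : {set L}) : phi (s @: B) t != 0 -> t \subset q @: B.
  move=> tn; have [|h _] := phiP (s @: B).
    by rewrite (leq_trans (leq_imset_card _ _)) // -[X in (_ <= X)%N]card_ord max_card.
  have [_ + _] := h t tn; move/subset_trans; apply.
  apply/bigcupsP => _ /imsetP[j jB ->]; rewrite c_slack sub1set.
  by rewrite imset_f.
have [|_] := phiP (s @: A).
  by rewrite (leq_trans (leq_imset_card _ _)) // -[X in (_ <= X)%N]card_ord max_card.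
move/ffunP/(_ (q @: (A :\ i))); rewrite ffunE sum_ffunE.
have qi : q i \notin q @: (A :\ i) by rewrite mem_imset // !inE eqxx.
rewrite (bigD1 (q i)) //= big1 ?addr0; last first.
  move=> x /andP[xn xi]; apply/eqP; apply: contraT => /sub.
  rewrite subUset sub1set => /andP[/imsetP[j jA xj] _].
  case/negP: xn; rewrite xj mem_imset // !inE jA andbT.
  by apply: contraNneq xi => <-; rewrite xj.
rewrite (bigD1 (s i)) /=; last by rewrite imset_f.
rewrite big1 ?addr0; last first.
  move=> v /andP[/imsetP[j jA ->] ji]; rewrite sD //; apply/eqP; apply: contraT => /sub.
  have ij : i != j by apply: contraNneq ji => ->.
  move/subsetP/(_ (q j)); rewrite !mem_imset // !inE eqxx jA eq_sym ij.
  by move/(_ isT).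
rewrite sD // IH; last first.
  by move: cA; rewrite (cardsD1 i) iA.
by rewrite -imsetU1 setD1K.
Qed.

Lemma rainbow_scarf : exists sg T,
  [/\ dominating f sg, #|sg| = k.+1, carrier col c (slacks s) sg T & D T].
Proof.
have c_neq0 w : c w != set0.
  have [/imsetP[i _ ->]|/c_col h] := boolP (w \in slacks s).
    by rewrite c_slack -cards_eq0 cards1.
  rewrite -card_gt0; apply: leq_trans (leq_imset_card col _).
  exact: leq_ltn_trans h.
have [phi [phi0 phiP]] := @carrier_chain_map W L C col c (slacks s) k c_neq0 c_col.
pose Dom := [set sg : {set W} | (#|sg| == k.+1) && (dominating f sg || (sg == slacks s))].
pose Z := \sum_(sg in Dom) phi sg.
have cS : #|slacks s| = k.+1 by rewrite card_imset // cardsT card_ord.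
have bdZ : bd Z = 0.
  have -> : bd Z = \sum_v \sum_(tau : {set W} | (v \notin tau) && (v |: tau \in Dom)) phi tau.
    rewrite bd_sum.
    under eq_bigr => sg; first by rewrite inE => /andP[/eqP csg _];
      have [|_ ->] := phiP sg; first (by rewrite csg); over.
    rewrite (exchange_big_dep predT) //=; apply: eq_bigr => v _.
    rewrite (reindex_onto (fun t : {set W} => v |: t) (fun t : {set W} => t :\ v)) /=; last first.
      by move=> t /andP[_ vt]; rewrite setD1K.
    apply: eq_big => [t|t /andP[_ /eqP->//]].
    rewrite in_setU1 eqxx /= andbT andbC; congr (_ && _).
    apply/eqP/idP => [<-|vt]; first by rewrite !inE eqxx.
    by rewrite setU1K.
  rewrite (exchange_big_dep predT) //= big1 // => tau _.
  have [/eqP ct|ct] := boolP (#|tau| == k); last first.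
    rewrite big_pred0 // => v; apply/negP => /andP[vt].
    by rewrite inE cardsU1 vt add1n eqSS (negPf ct).
  have E v : (v \notin tau) && (v |: tau \in Dom) =
     (v \notin tau) && (dominating f (v |: tau) || (v |: tau == slacks s)).
    by rewrite inE cardsU1 ct; case: (v \notin tau); rewrite //= add1n eqxx.
  rewrite (eq_bigl _ _ E).
  have [[za [zb [ab h]]]|h] := room_parity f_inj s_inj s_low s_high k_gt0 ct nonslack; last first.
    by rewrite big_pred0.
  rewrite (eq_bigl _ _ h) (bigD1 za) ?eqxx //= (bigD1 zb) /=; last first.
    by rewrite eqxx orbT eq_sym.
  rewrite big_pred0 ?addr0 ?chain_addrr // => z.
  by case: (z == za); case: (z == zb).
have cZ : carried (fun t : {set L} => #|t| = k.+1) Z.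
  apply: carried_sum => sg; rewrite inE => /andP[/eqP csg _] t tn.
  have [|h _] := phiP sg; first by rewrite csg.
  by have [-> _ _] := h t tn.
(* Every cycle bounds a cone, so the total degree vanishes; as [slacks s] alone contributes one,
   some dominating set must contribute too. *)
have dZ : degree Z = 0.
  rewrite -(bd_cone_cycle (q ord0) bdZ); apply: degree_bd => t; rewrite ffunE.
  case: ifP => [at_|]; last by rewrite eqxx.
  by move/cZ => ct; rewrite (cardsD1 (q ord0)) at_ ct.
have degS : degree (phi (slacks s)) = 1.
  rewrite /degree (bigD1 (q @: [set: 'I_k.+1])) //= (chain_map_slack phi0 phiP) big1 ?addr0 //.
  move=> t /andP[_ tn]; apply/eqP; apply: contraNT tn => tn.
  have [|h _] := phiP (slacks s); first by rewrite cS.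
  have [h1 h2 _] := h t tn; rewrite eqEcard h1 cS card_imset // cardsT card_ord leqnn andbT.
  apply: subset_trans h2 _; apply/bigcupsP => _ /imsetP[j _ ->].
  by rewrite c_slack sub1set imset_f.
have [/existsP[sg /andP[/andP[/eqP csg dsg] /existsP[T /andP[Dt Tn]]]]|none] :=
    boolP [exists sg : {set W}, (#|sg| == k.+1) && dominating f sg &&
       [exists T : {set L}, D T && (phi sg T != 0)]].
  exists sg, T; split => //; have [|h _] := phiP sg; first by rewrite csg.
  exact: h.
have : degree Z = 1; last by rewrite dZ.
rewrite /Z degree_sum (bigD1 (slacks s)) /=; last by rewrite inE cS !eqxx orbT.
rewrite degS big1 ?addr0 // => sg /andP[].
rewrite inE => /andP[csg] /orP[dsg _|/eqP->]; last by rewrite eqxx.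
rewrite /degree big1 // => T DT; apply/eqP; apply: contraNT none => Tn.
apply/existsP; exists sg; rewrite csg dsg /=; apply/existsP; exists T.
by rewrite DT.
Qed.

End RainbowScarf.

(** * Primitive sets of grid points *)

Section Grid.
Variables (k N : nat).

Definition grid := {a : {ffun 'I_k.+1 -> 'I_N.+1} | \sum_i a i == N}.
Definition vertex := (grid + 'I_k.+1)%type.

(* Ties between equal coordinates are broken by the enumeration of the grid. *)
Definition vertex_rank (i : 'I_k.+1) (w : vertex) : nat :=
  match w with
  | inl a => (val a i * #|{: grid}| + enum_rank a).+1
  | inr j => if j == i then 0 else (N.+1 * #|{: grid}| + j).+1
  end.

Lemma rank_lt (a : grid) : (enum_rank a < #|{: grid}|)%N.
Proof. exact: ltn_ord. Qed.

Lemma vertex_rank_bound i (a : grid) :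
  (val a i * #|{: grid}| + enum_rank a < N.+1 * #|{: grid}|)%N.
Proof.
have h := rank_lt a; have h' := ltn_ord (val a i).
apply: leq_trans (_ : (val a i).+1 * #|{: grid}| <= _)%N; last by rewrite leq_mul2r h' orbT.
by rewrite mulSn addnC ltn_add2r.
Qed.

Lemma vertex_rank_mono i (a a' : grid) : (val a i < val a' i)%N ->
  (vertex_rank i (inl a) < vertex_rank i (inl a'))%N.
Proof.
move=> h; rewrite /= ltnS; have h' := rank_lt a.
apply: leq_trans (_ : (val a i).+1 * #|{: grid}| <= _)%N.
  by rewrite mulSn addnC ltn_add2r.
by apply: leq_trans (leq_addr _ _); rewrite leq_mul2r h orbT.
Qed.

Lemma vertex_rank_inj i : injective (vertex_rank i).
Proof.
move=> [a|j] [a'|j'] /=.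
- have [h|h|h] := ltngtP (val a i) (val a' i).
  + by have := vertex_rank_mono h; rewrite /= => + e; rewrite e ltnn.
  + by have := vertex_rank_mono h; rewrite /= => + e; rewrite e ltnn.
  + by rewrite h => -[/addnI/val_inj/enum_rank_inj ->].
- case: ifP => // _ [e]; have := vertex_rank_bound i a; rewrite e.
  by rewrite ltnNge leq_addr.
- case: ifP => // _ [e]; have := vertex_rank_bound i a'; rewrite -e.
  by rewrite ltnNge leq_addr.
- case: eqP => [->|_]; case: eqP => [->|_] // [/addnI/val_inj ->] //.
Qed.

Definition corner (i : 'I_k.+1) : vertex := inr i.

Lemma corner_low i w : (vertex_rank i (corner i) <= vertex_rank i w)%N.
Proof. by rewrite /= eqxx. Qed.

Lemma corner_high i j w : i != j -> w \notin codom corner ->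
  (vertex_rank i w < vertex_rank i (corner j))%N.
Proof.
case: w => [a|l] ij; last by rewrite (codom_f corner l).
rewrite /= eq_sym (negPf ij) ltnS => _.
by apply: leq_trans (vertex_rank_bound i a) _; rewrite leq_addr.
Qed.

Lemma mem_corners (w : vertex) :
  (w \in slacks corner) = (if w is inr _ then true else false).
Proof.
case: w => [a|j]; first by apply/imsetP => -[].
by rewrite (_ : inr j = corner j) // imset_f.
Qed.

Lemma grid_inhabited (n : 'I_k.+1 -> nat) : (\sum_i n i <= N)%N ->
  exists a : grid, forall i, (n i <= val a i)%N.
Proof.
move=> nN; pose b (i : 'I_k.+1) := (n i + (N - \sum_i n i) * (i == ord0))%N.
have sb : (\sum_i b i = N)%N.
  have e1 : (\sum_(i < k.+1) (i == ord0 : nat) = 1)%N.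
    by rewrite (bigD1 ord0) //= big1 // => i /negPf ->.
  by rewrite big_split /= -big_distrr /= e1 muln1 subnKC.
have bN i : (b i < N.+1)%N by rewrite ltnS -sb (bigD1 i) //= leq_addr.
pose a : {ffun 'I_k.+1 -> 'I_N.+1} := [ffun i => Ordinal (bN i)].
have aN : \sum_i a i == N by rewrite -[X in _ == X]sb; apply/eqP/eq_bigr => i _; rewrite ffunE.
by exists (exist _ a aN) => i; rewrite /= ffunE /= leq_addr.
Qed.

Lemma grid_corners : exists w, w \notin slacks corner.
Proof.
have [|a _] := @grid_inhabited (fun=> 0%N); first by rewrite big1.
by exists (inl a); rewrite mem_corners.
Qed.

(* The thresholds [n i] are one more than the minima of the coordinates over
   [sg]; a grid point above all of them would not be dominated, so they add up
   to more than [N] and leave little room for the points of [sg]. *)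
Lemma dominating_clustered (sg : {set vertex}) :
  dominating vertex_rank sg -> #|sg| = k.+1 ->
  (exists a, inl a \in sg) /\
  forall a i, inl a \in sg ->
    (inr i \in sg -> (val a i <= k)%N) /\
    forall a', inl a' \in sg -> (val a i <= val a' i + k)%N.
Proof.
move=> ds cs.
have [a0 a0s] : exists a, inl a \in sg.
  have /existsP[a ?] : [exists a, inl a \in sg]; last by exists a.
  apply: contraT; rewrite negb_exists => /forallP h.
  have sS : sg = slacks corner.
    apply/eqP; rewrite eqEcard; apply/andP; split.
      apply/subsetP => -[a|j] js; last by rewrite mem_corners.
      by have := h a; rewrite js.
    by rewrite cs card_imset ?cardsT ?card_ord // => i j [].
  have := slacks_not_dominating vertex_rank_inj corner_low grid_corners.
  by rewrite -sS ds.
split; first by exists a0.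
have [n [n0 nle nge]] : exists n : 'I_k.+1 -> nat,
    [/\ forall i, inr i \in sg -> n i = 0%N,
        forall a i, inl a \in sg -> (n i <= (val a i).+1)%N &
        (N < \sum_i n i)%N].
  have h i : {a : grid | inl a \in sg & forall a', inl a' \in sg -> (val a i <= val a' i)%N}.
    by case: (arg_minnP (P := fun a : grid => inl a \in sg)
      (fun a : grid => val a i) a0s) => a; exists a.
  (* A slack of [sg] is the minimum of its own row and lies below every grid point there, so that
     row imposes no threshold. *)
  exists (fun i => if inr i \in sg then 0%N else (val (s2val (h i)) i).+1); split.
  - by move=> i ->.
  - by move=> a i ai; case: ifP => // _; case: (h i) => /= b _ /(_ a ai).
  - rewrite ltnNge; apply/negP => /grid_inhabited[a ha].
    have /dominatingP/(_ (inl a))[i hi] := ds.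
    have := ha i; case: ifP => [/hi|_]; first by rewrite /= eqxx.
    case: (h i) => /= b bs _ lt.
    by have := vertex_rank_mono lt; rewrite ltnNge hi.
(* Each of the other [k] coordinates falls short of its threshold by at most one, while the
   thresholds exceed [N] in total. *)
have up a i : inl a \in sg -> (val a i < n i + k)%N.
  move=> ai; have /eqP := valP a; rewrite (bigD1 i) //= => e.
  move: nge; rewrite (bigD1 i) //= => nge.
  have : (\sum_(j | j != i) n j <= \sum_(j | j != i) (val a j + 1))%N.
    by apply: leq_sum => j _; rewrite addn1 nle.
  rewrite big_split /= sum1_card cardC1 card_ord /=.
  set X := (\sum_(j | j != i) n j)%N in nge *.
  set Y := (\sum_(j | j != i) _)%N in e *; move: (n i) (val a i : nat) e nge; lia.
move=> a i ai; split=> [si|a' a's].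
  by have := up a i ai; rewrite n0 // add0n => /ltnW.
have := up a i ai; have := nle a' i a's; move: (n i) (val a i : nat) (val a' i : nat); lia.
Qed.

End Grid.

From mathcomp Require Import all_classical all_reals all_analysis.
Require Import Defs.
Import Order.TTheory GRing.Theory Num.Theory.
Import numFieldTopology.Exports numFieldNormedType.Exports.
Local Open Scope ring_scope.

(** * Euclidean projection and generic points *)

Section Dot.
Variables (R : realType) (d : nat).
Implicit Types x y z : 'rV[R]_d.

Lemma dotvC x y : dotv x y = dotv y x.
Proof. by apply: eq_bigr => j _; rewrite mulrC. Qed.

Lemma dotvDr x y z : dotv x (y + z) = dotv x y + dotv x z.
Proof. by rewrite -big_split; apply: eq_bigr => j _; rewrite mxE mulrDr. Qed.

Lemma dotvZr a x y : dotv x (a *: y) = a * dotv x y.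
Proof. by rewrite /dotv mulr_sumr; apply: eq_bigr => j _; rewrite mxE mulrCA. Qed.

Lemma dotvBr x y z : dotv x (y - z) = dotv x y - dotv x z.
Proof. by rewrite -scaleN1r dotvDr dotvZr mulN1r. Qed.

Lemma dotvBl x y z : dotv (x - y) z = dotv x z - dotv y z.
Proof. by rewrite !(dotvC _ z) dotvBr. Qed.

Lemma dotv_sumr (I : finType) x (a : I -> R) (y : I -> 'rV[R]_d) :
  dotv x (\sum_i a i *: y i) = \sum_i a i * dotv x (y i).
Proof.
rewrite /dotv; under eq_bigr do rewrite summxE mulr_sumr.
rewrite exchange_big; apply: eq_bigr => i _ /=; rewrite mulr_sumr.
by apply: eq_bigr => j _; rewrite mxE mulrCA.
Qed.

Lemma dotv_delta x i : dotv x (delta_mx 0 i) = x 0 i.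
Proof.
rewrite /dotv (bigD1 i) //= big1 ?mxE ?eqxx ?mulr1 ?addr0 // => j ji.
by rewrite mxE (negPf ji) andbF mulr0.
Qed.

Lemma dotv_sqr_ge0 x : 0 <= dotv x x.
Proof. by apply: sumr_ge0 => j _; rewrite -expr2 sqr_ge0. Qed.

Lemma dotv_le x y a b : 0 <= a -> (forall j, `|x 0 j| <= a) -> (forall j, `|y 0 j| <= b) ->
  `|dotv x y| <= d%:R * (a * b).
Proof.
move=> a0 xa yb; apply: le_trans (ler_norm_sum _ _ _) _.
apply: le_trans (_ : \sum_(j < d) a * b <= _).
  by apply: ler_sum => j _; rewrite normrM ler_pM.
by rewrite sumr_const card_ord mulr_natl.
Qed.

(** The nearest point of a convex set in variational form: the functional [x - r] attains its
    maximum over [Q] at [r], which is how labels are tied to exposed faces. *)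
Definition is_projection (Q : set 'rV[R]_d) (x r : 'rV[R]_d) :=
  Q r /\ forall y, Q y -> dotv (x - r) (y - r) <= 0.

(** The two variational inequalities add up to [dotv (r - r') (r - r') <= dotv (x - x') (r - r')];
    the square of [(x - x') - (r - r')] does the rest. *)
Lemma projection_nonexpansive Q x x' r r' :
  is_projection Q x r -> is_projection Q x' r' ->
  dotv (r - r') (r - r') <= dotv (x - x') (x - x').
Proof.
move=> [Qr h] [Qr' h']; have := h _ Qr'; have := h' _ Qr.
have := dotv_sqr_ge0 ((x - x') - (r - r')).
rewrite !(dotvBr, dotvBl) (dotvC x' x) (dotvC r' r) (dotvC r x) (dotvC r x')
  (dotvC r' x) (dotvC r' x'); lra.
Qed.

(** The square root of [d] would do as the factor; [d%:R] is cruder and avoids roots. *)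
Lemma projection_close Q x x' r r' e : 0 <= e ->
  is_projection Q x r -> is_projection Q x' r' ->
  (forall j, `|x 0 j - x' 0 j| <= e) -> forall j, `|r 0 j - r' 0 j| <= d%:R * e.
Proof.
move=> e0 hr hr' xe j; have d1 : 1 <= d%:R :> R.
  by rewrite ler1n; case: (d) j => // -[].
have h := projection_nonexpansive hr hr'.
have h1 : dotv (x - x') (x - x') <= d%:R * (e * e).
  apply: le_trans (ler_norm _) _; apply: dotv_le => // i; rewrite !mxE; exact: xe.
have h2 : `|r 0 j - r' 0 j| ^+ 2 <= dotv (r - r') (r - r').
  rewrite real_normK ?num_real // /dotv (bigD1 j) //= !mxE -expr2 lerDl.
  by apply: sumr_ge0 => i _; rewrite -expr2 sqr_ge0.
rewrite -(@ler_pXn2r _ 2) ?nnegrE ?mulr_ge0 ?ler0n //.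
apply: le_trans h2 (le_trans h (le_trans h1 _)).
rewrite -expr2 exprMn ler_wpM2r ?exprn_ge0 // expr2.
by rewrite ler_peMl // ler0n.
Qed.

End Dot.

Section Generic.
Variables (R : realType) (k : nat) (L : finType) (u : L -> 'rV[R]_k.+1).

Lemma common_normal (t : {set L}) : (#|t| <= k)%N ->
  exists2 a : 'rV[R]_k.+1, a != 0 & forall l, l \in t -> dotv a (u l) = 0.
Proof.
move=> ct; pose M := (\matrix_(i < #|t|) u (enum_val i))^T.
have kn0 : kermx M != 0.
  rewrite -mxrank_eq0 mxrank_ker subn_eq0 -ltnNge ltnS.
  exact: leq_trans (rank_leq_col M) ct.
have /rowV0Pn[a /sub_kermxP aM an0] := kn0.
exists a => // l lt; have /rowP/(_ (enum_rank_in lt l)) := aM.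
rewrite !mxE => h; apply: etrans h; apply: eq_bigr => j _.
by rewrite !mxE enum_rankK_in.
Qed.

(** The moment curve without constant term: its coordinates are positive for [s > 0] and tend to
    zero with [s], and its product with a nonzero vector is a nonzero polynomial in [s]. *)
Definition curve (s : R) : 'rV[R]_k.+1 := \row_j s ^+ j.+1.

(* Each [k]-subset of the labels spans a proper subspace, met by the curve
   [p + curve s] for finitely many [s] only. *)
Lemma generic_near (p : 'rV[R]_k.+1) (e : R) : 0 < e ->
  exists s, [/\ 0 < s, s <= e & generic u (p + curve s)].
Proof.
move=> e0.
have [a aP] : exists a : {set L} -> 'rV[R]_k.+1, forall t : {set L}, (#|t| <= k)%N ->
    a t != 0 /\ forall l, l \in t -> dotv (a t) (u l) = 0.
  apply: (fin_all_exists (P := fun (t : {set L}) b => (#|t| <= k)%N ->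
    b != 0 /\ forall l, l \in t -> dotv b (u l) = 0)) => t.
  have [/common_normal[b b0 h]|_] := boolP (#|t| <= k)%N; last by exists 0.
  by exists b.
pose P t : {poly R} := (dotv (a t) p)%:P + \sum_(j < k.+1) a t 0 j *: 'X^(j.+1).
have PE t s : (P t).[s] = dotv (a t) (p + curve s).
  rewrite dotvDr /P hornerD hornerC horner_sum; congr (_ + _).
  by apply: eq_bigr => j _; rewrite hornerZ hornerXn mxE.
have Pn0 (t : {set L}) : (#|t| <= k)%N -> P t != 0.
  move=> /aP[an0 _]; apply: contra an0 => /eqP P0; apply/eqP/rowP => j.
  have := congr1 (fun q : {poly R} => q`_j.+1) P0.
  rewrite /P coefD coefC coef0 add0r coef_sum (bigD1 j) //= coefZ coefXn eqxx mulr1.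
  rewrite big1 ?addr0 ?mxE // => i ij; rewrite coefZ coefXn eqSS.
  by case: eqP => [/val_inj ji|]; rewrite ?mulr0 //; rewrite ji eqxx in ij.
pose Q := \prod_(t : {set L} | (#|t| <= k)%N) P t.
have Qn0 : Q != 0 by apply/prodf_neq0 => t /Pn0.
(* Distinct candidates in the allowed range, one more than the degree of [Q], so they cannot all be
   roots. *)
pose rs := [seq e / i.+1%:R | i <- iota 0 (size Q)].
have urs : uniq rs.
  rewrite map_inj_uniq ?iota_uniq // => i j /(mulfI (lt0r_neq0 e0))/invr_inj/eqP.
  by rewrite eqr_nat => /eqP [].
have : ~~ all (root Q) rs.
  apply/negP => h; have := max_poly_roots Qn0 h urs.
  by rewrite size_map size_iota ltnn.
case/allPn => s /mapP[i _ se] sQ; exists s; split.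
- by rewrite se divr_gt0 // ltr0n.
- by rewrite se ler_pdivrMr ?ltr0n //; apply: ler_peMr; rewrite ?ler1n // ltW.
move=> lam hl; rewrite leqNgt ltnS; apply/negP => ct.
case/negP: sQ; rewrite rootE horner_prod.
set t := [set l | lam l != 0] in ct; rewrite (bigD1 t) //= PE -hl dotv_sumr big1 ?mul0r //.
move=> l _; have [lt|] := boolP (l \in t); first by rewrite (aP t ct).2 // mulr0.
by rewrite inE negbK => /eqP ->; rewrite mul0r.
Qed.

End Generic.

(** * The approximate theorem *)

Section Approximation.
Variables (R : realType) (k : nat).
Local Notation vec := 'rV[R]_k.+1.
Local Notation K1 := (k.+1%:R : R).
Variables (Q : set vec) (b : R).
Hypothesis b_ge1 : 1 <= b.
Hypothesis Q_bounded : forall x, Q x -> forall j, `|x 0 j| <= b.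
Hypothesis Q_sum1 : forall x, Q x -> \sum_j x 0 j = 1.
Hypothesis Q_delta : forall i, Q (delta_mx 0 i).

Lemma K1_ge1 : 1 <= K1. Proof. by rewrite ler1n. Qed.

(* The functional [x - r] is maximal over [Q] at [r]. Since the basis vectors lie in
   [Q], adding the positive vector [c] to [p] keeps it strictly below this maximum,
   so [p + c] is no combination of labels that nearly reach the maximum. *)
Lemma slack_bound (L : finType) (u : L -> vec) (lam : L -> R) (p c x r : vec)
    (i0 : 'I_k.+1) (kap e : R) :
  Q p -> (forall j, 0 <= c 0 j) -> kap <= c 0 i0 -> 0 <= kap ->
  is_projection Q x r -> \sum_j x 0 j = 1 -> (x - r) 0 i0 <= -1 ->
  (forall l, \sum_j u l 0 j = 1) -> (forall l, 0 <= lam l) ->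
  \sum_l lam l *: u l = p + c ->
  (forall l, lam l != 0 -> dotv (x - r) r - e <= dotv (x - r) (u l)) ->
  kap <= (1 + \sum_j c 0 j) * e.
Proof.
move=> Qp c0 kc kap0 [Qr hr] sx wi su lam0 lamE hl.
set w := x - r in wi hl *; set mm := dotv w r in hl *.
have wmax y : Q y -> dotv w y <= mm by move=> /hr; rewrite dotvBr subr_le0.
have wj j : w 0 j <= mm by rewrite -dotv_delta wmax.
have sw : \sum_j w 0 j = 0.
  under eq_bigr do rewrite !mxE; by rewrite sumrB sx Q_sum1 // subrr.
have mm0 : 0 <= mm.
  have : \sum_j w 0 j <= \sum_(j < k.+1) mm by apply: ler_sum.
  by rewrite sw sumr_const card_ord pmulrn_lge0.
have sl : \sum_l lam l = 1 + \sum_j c 0 j.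
  rewrite (coefficient_sum su lamE); under eq_bigr do rewrite mxE.
  by rewrite big_split /= Q_sum1.
have low : (1 + \sum_j c 0 j) * (mm - e) <= dotv w (p + c).
  rewrite -lamE dotv_sumr -sl mulr_suml; apply: ler_sum => l _.
  have [->|ln] := eqVneq (lam l) 0; first by rewrite !mul0r.
  by rewrite ler_wpM2l // hl.
have high : dotv w (p + c) <= mm + (mm * \sum_j c 0 j - kap).
  rewrite dotvDr lerD ?wmax // /dotv mulr_sumr lerBrDr -lerBrDl -sumrB.
  rewrite (bigD1 i0) //= -[kap]addr0 lerD //.
    rewrite -mulrBl; apply: le_trans kc _; rewrite ler_peMl //.
    by have := mm0; lra.
  by apply: sumr_ge0 => j _; rewrite -mulrBl mulr_ge0 // subr_ge0.
have := le_trans low high; set T := \sum_j c 0 j; nra.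
Qed.

(** The image of [delta_mx 0 i] under the homothety of ratio [- K] about the barycentre of the
    standard simplex. A functional [w] of coordinate sum zero takes the value [- K * w 0 i] on it,
    which is large when [w 0 i <= -1], as happens near the slack vertex [i]. *)
Definition corner_label (K : R) (i : 'I_k.+1) : vec :=
  \row_j ((1 + K) / K1 - K * (i == j)%:R).

Lemma sum_eq (V : pzRingType) (i : 'I_k.+1) (F : 'I_k.+1 -> V) :
  \sum_j F j * (j == i)%:R = F i.
Proof.
rewrite (bigD1 i) //= eqxx mulr1 big1 ?addr0 // => j /negPf ->.
by rewrite mulr0.
Qed.

Lemma corner_label_sum K i : \sum_j corner_label K i 0 j = 1.
Proof.
under eq_bigr do rewrite mxE eq_sym.
rewrite sumrB sumr_const card_ord (sum_eq i (fun=> K)) -[X in X - _]mulr_natr divfK ?addrK //.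
Qed.

Lemma dotv_corner K i (w : vec) : \sum_j w 0 j = 0 ->
  dotv w (corner_label K i) = - K * w 0 i.
Proof.
move=> w0; rewrite /dotv.
under eq_bigr => j _ do rewrite [corner_label _ _ _ _]mxE mulrBr eq_sym [_ * (K * _)]mulrA.
by rewrite sumrB -mulr_suml w0 mul0r sub0r (sum_eq i (fun j => w 0 j * K)) mulrC mulNr.
Qed.

Lemma corner_label_span K (v : vec) : K1 * (b + 1) <= K -> 0 < K ->
  (forall j, v 0 j <= b + 1) -> 1 <= \sum_j v 0 j ->
  exists al : 'I_k.+1 -> R, (forall i, 0 <= al i) /\
     \sum_i al i *: corner_label K i = v.
Proof.
move=> hK K0 vb v1; set T := \sum_j v 0 j in v1.
have K1n0 : K1 != 0 by rewrite pnatr_eq0.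
(* The coefficients must total [T], so coordinate [j] reads [T * (1 + K) / K1 - K * al j = v 0 j],
   which is solved for [al j]. *)
exists (fun i => (T * (1 + K) / K1 - v 0 i) / K); split.
  move=> i; apply: divr_ge0; last exact: ltW.
  rewrite subr_ge0; apply: le_trans (vb i) _.
  rewrite ler_pdivlMr ?ltr0n // [X in X <= _]mulrC; apply: le_trans hK _.
  apply: le_trans (_ : 1 * (1 + K) <= _); first by rewrite mul1r lerDr.
  by rewrite ler_wpM2r // addr_ge0 // ltW.
apply/rowP => j; rewrite summxE.
pose X i := T * (1 + K) / K1 - v 0 i.
have Kn0 : K != 0 by rewrite gt_eqF.
transitivity (\sum_i (X i * ((1 + K) / K1 / K) - X i * (i == j)%:R)).
  by apply: eq_bigr => i _; rewrite !mxE -/(X i); field; rewrite nat1r Kn0.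
rewrite sumrB (sum_eq j X) -mulr_suml /X sumrB sumr_const card_ord -/T.
by rewrite -(mulr_natr (T * (1 + K) / K1) k.+1); field; rewrite nat1r Kn0 andbT.
Qed.

(** The side of the simplex of coordinate sum one whose coordinates are all at least [- (b + 2)].
    Points of [Q] have coordinates at least [- b], so a grid point within one of facet [i] lies at
    least one below its projection in coordinate [i]. *)
Definition grid_side : R := 1 + K1 * (b + 2).
Definition grid_point N (a : grid k N) : vec :=
  \row_j (- (b + 2) + grid_side * (val a j)%:R / N%:R).

Lemma grid_point_sum N (a : grid k N) : (0 < N)%N -> \sum_j grid_point a 0 j = 1.
Proof.
move=> N0; under eq_bigr do rewrite mxE.
rewrite big_split /= sumr_const card_ord -mulr_suml -mulr_sumr -natr_sum.
rewrite (eqP (valP a)) mulfK ?pnatr_eq0 -?lt0n // /grid_side -mulr_natl; ring.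
Qed.

Lemma grid_side_gt0 : 0 < grid_side.
Proof.
rewrite /grid_side ltr_wpDr // mulr_ge0 ?ler0n //; have := b_ge1; lra.
Qed.

Lemma grid_point_bound N (a : grid k N) j : (0 < N)%N -> `|grid_point a 0 j| <= grid_side.
Proof.
move=> N0; rewrite mxE.
have hb := b_ge1; have h1 : 0 <= (val a j)%:R / N%:R :> R by rewrite divr_ge0 ?ler0n.
have h2 : (val a j)%:R / N%:R <= 1 :> R.
  by rewrite ler_pdivrMr ?ltr0n // mul1r ler_nat -ltnS.
have h3 := grid_side_gt0.
have h4 : b + 2 <= grid_side.
  have := K1_ge1; rewrite /grid_side; nra.
rewrite -mulrA ler_norml; apply/andP; split; nra.
Qed.

Lemma grid_point_close N (a a' : grid k N) j : (0 < N)%N ->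
  (val a j <= val a' j + k)%N -> (val a' j <= val a j + k)%N ->
  `|grid_point a 0 j - grid_point a' 0 j| <= k%:R * grid_side / N%:R.
Proof.
move=> N0 h h'; rewrite !mxE.
have -> : - (b + 2) + grid_side * (val a j)%:R / N%:R -
   (- (b + 2) + grid_side * (val a' j)%:R / N%:R) =
   ((val a j)%:R - (val a' j)%:R) * (grid_side / N%:R) by ring.
have h0 : 0 <= grid_side / N%:R by rewrite divr_ge0 ?ler0n // ltW ?grid_side_gt0.
rewrite normrM [X in _ * X]ger0_norm // -mulrA ler_wpM2r //.
have h1 : (val a j)%:R <= (val a' j)%:R + k%:R :> R by rewrite -natrD ler_nat.
have h2 : (val a' j)%:R <= (val a j)%:R + k%:R :> R by rewrite -natrD ler_nat.
by rewrite ler_norml lerBlDl h1 andbT lerNl opprB lerBlDl h2.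
Qed.

Variables (Lb C : finType) (u0 : Lb -> vec) (col : Lb -> C) (A : Lb -> set vec).
Hypothesis k_gt0 : (0 < k)%N.
Hypothesis Q_label : forall l, Q (u0 l).
Hypothesis Q_proj : forall x, exists r, is_projection Q x r.
Hypothesis Q_cover : forall w r, Q r -> (forall y, Q y -> dotv w y <= dotv w r) ->
  (k < #|col @: [set l | `[< A l r /\ dotv w (u0 l) = dotv w r >]]|)%N.

Lemma approximate_rainbow (p : vec) (eta : R) : Q p -> 0 < eta ->
  exists (T : 'I_k.+1 -> Lb) (z : 'I_k.+1 -> vec) (mu : 'I_k.+1 -> R),
  [/\ injective (col \o T),
      forall i, Q (z i) /\ A (T i) (z i),
      forall i i' j, `|z i 0 j - z i' 0 j| <= eta,
      (forall i, 0 <= mu i) /\ \sum_i mu i = 1 &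
      forall j, `|(\sum_i mu i *: u0 (T i)) 0 j - p 0 j| <= eta].
Proof.
move=> Qp eta0.
have K1g := K1_ge1; have S0 := grid_side_gt0; have b1 := b_ge1.
have b0 : 0 <= b by lra.
(* The first term bounds [dotv (w a) (r a)], so a corner label in use exceeds the maximum over [Q];
   the second lets the corner labels span [p + c]. *)
pose K := K1 * ((grid_side + b) * b) + K1 * (b + 1).
have KA : 0 <= K1 * ((grid_side + b) * b) by rewrite !mulr_ge0 ?ler0n //; lra.
have KB : 1 <= K1 * (b + 1) by nra.
have K0 : 0 < K by rewrite /K; lra.
pose u (l : Lb + 'I_k.+1) := match l with inl l => u0 l | inr i => corner_label K i end.
have su l : \sum_j u l 0 j = 1.
  by case: l => [l|i] /=; rewrite ?corner_label_sum // Q_sum1.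
(* The first bound keeps the total of [c] at most one, the second keeps the displacement caused by
   [c] within [eta]. *)
have e0 : 0 < Num.min K1^-1 (eta / (1 + b * K1)).
  by rewrite lt_min invr_gt0 ltr0n divr_gt0 //; nra.
have [s [s0 se gs]] := generic_near u p e0.
move: se; rewrite le_min => /andP[sK seta].
have s1 : s <= 1 by apply: le_trans sK _; rewrite invf_le1 // ltr0n.
pose c : vec := curve k s.
have c0 j : 0 < c 0 j by rewrite mxE exprn_gt0.
have cs j : c 0 j <= s by rewrite mxE exprS ler_piMr ?exprn_ile1 // ltW.
pose kap := s ^+ k.+1.
have kap0 : 0 < kap by rewrite exprn_gt0.
have kapc j : kap <= c 0 j by rewrite mxE ler_wiXn2l // ltW.
have Sc0 : 0 <= \sum_j c 0 j by apply: sumr_ge0 => j _; apply: ltW.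
have ScK : \sum_j c 0 j <= K1 * s.
  apply: le_trans (_ : \sum_(j < k.+1) s <= _); first by apply: ler_sum.
  by rewrite sumr_const card_ord mulr_natl.
have Sc1 : \sum_j c 0 j <= 1.
  by apply: le_trans ScK _; rewrite -ler_pdivlMl ?ltr0n // mulr1.
have err (pj cj X : R) : cj <= s -> `|pj| <= b -> 0 <= X -> X <= K1 * s ->
    cj + `|pj| * X <= eta * (1 + X).
  move=> cjs pb X0 XK.
  have h1 : `|pj| * X <= b * (K1 * s) by apply: ler_pM.
  have h2 : s * (1 + b * K1) <= eta by move: seta; rewrite ler_pdivlMr //; nra.
  have h3 : 0 <= eta * X by apply: mulr_ge0 => //; apply: ltW.
  move: (`|pj| * X) h1 => Y h1; move: (b * K1) (mulrA b K1 s) h1 h2 => B -> h1 h2.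
  by rewrite mulrDr mulr1; nra.
(* The bound [1] keeps a set containing a slack within one of its facet, [eta / K1] keeps the
   projections within [eta], and the last bound makes twice the label error [E] smaller than [kap],
   against [slack_bound]. *)
pose g0 := Num.min 1 (Num.min (eta / K1) (kap / (5 * b * K1 * (1 + K1)))).
have g00 : 0 < g0.
  by rewrite !lt_min ltr01 !divr_gt0 ?ltr0n // !mulr_gt0 ?ltr0n //; lra.
pose N := (Num.bound (k%:R * grid_side / g0)).+1.
have NP : k%:R * grid_side / N%:R <= g0.
  have h : 0 <= k%:R * grid_side / g0 by rewrite !mulr_ge0 ?ler0n ?invr_ge0 // ltW.
  have := archi_boundP h; rewrite ltr_pdivrMr // => /ltW h'.
  rewrite ler_pdivrMr ?ltr0n // [X in _ <= X]mulrC; apply: le_trans h' _.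
  by apply: ler_wpM2r; [exact: ltW|rewrite ler_nat].
set g := k%:R * grid_side / N%:R in NP.
have g_ge0 : 0 <= g by rewrite !mulr_ge0 ?ler0n ?invr_ge0 ?ler0n // ltW.
move: NP; rewrite !le_min => /and3P[g1 geta gkap].
have N0 : (0 < N)%N by [].
have [r rP] : exists r : grid k N -> vec, forall a, is_projection Q (grid_point a) (r a).
  by have [r rP] := choice (fun a : grid k N => Q_proj (grid_point a)); exists r.
pose w a := grid_point a - r a.
pose lab a := [set l | `[< A l (r a) /\ dotv (w a) (u0 l) = dotv (w a) (r a) >]].
pose cW (v : vertex k N) : {set Lb + 'I_k.+1} :=
  match v with inl a => inl @: lab a | inr i => [set inr i] end.
pose colW (l : Lb + 'I_k.+1) : C + 'I_k.+1 :=
  match l with inl l => inl (col l) | inr i => inr i end.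
pose D (T : {set Lb + 'I_k.+1}) := `[< in_cone u (p + c) T >].
have inlI (X Y : Type) : injective (@inl X Y) by move=> ? ? [].
have [||||||||||sg [T [ds csg [cT TU Trb] /asboolP[lam [lam0 lamT lamE]]]]] :=
  @rainbow_scarf (vertex k N) (Lb + 'I_k.+1)%type (C + 'I_k.+1)%type k (@vertex_rank k N)
   (@corner k N) cW inr colW D k_gt0.
- exact: vertex_rank_inj.
- by move=> i j [].
- exact: corner_low.
- exact: corner_high.
- exact: grid_corners.
- by move=> i j [].
- by [].
- case=> [a|j]; rewrite mem_corners // => _.
  rewrite /cW -imset_comp.
  rewrite (_ : [set (colW \o inl) x | x in lab a] = inl @: (col @: lab a)); last first.
    by rewrite -imset_comp.
  rewrite card_imset; last exact: inlI.
  have [Qr hr] := rP a.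
  by apply: Q_cover => // y /hr; rewrite dotvBr subr_le0.
- move=> T cTT; have [h|[x [y [xT yT xy h]]]] := cone_facets su gs cTT.
    by left => x /h hx; apply/asboolP.
  right; exists x, y; split => // z /h hz; apply/asboolP/orP => [/hz[]->|[]/eqP->].
  + by left.
  + by right.
  + by apply/h => //; left.
  + by apply/h => //; right.
- have [|||al [al0 alE]] := @corner_label_span K (p + c) _ K0.
  + by rewrite /K; lra.
  + move=> j; rewrite mxE lerD //; last exact: le_trans (cs j) s1.
    by have := Q_bounded Qp j; rewrite ler_norml => /andP[].
  + under eq_bigr do rewrite mxE.
    by rewrite big_split /= Q_sum1 // lerDl.
  apply/asboolP; exists (fun l => if l is inr i then al i else 0); split.
  + by case.
  + by case=> // i; rewrite imset_f.
  + by rewrite big_sumType /= big1 ?add0r // => l _; rewrite scale0r.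
have [[a0 a0s] clus] := dominating_clustered ds csg.
have close a a' j : inl a \in sg -> inl a' \in sg ->
    `|grid_point a 0 j - grid_point a' 0 j| <= g.
  move=> as_ as'; apply: grid_point_close => //.
    exact: (clus a j as_).2.
  exact: (clus a' j as').2.
have rclose a a' j : inl a \in sg -> inl a' \in sg -> `|r a 0 j - r a' 0 j| <= K1 * g.
  by move=> as_ as'; apply: (projection_close g_ge0 (rP a) (rP a')) => i; apply: close.
have labT l : inl l \in T -> exists2 a, inl a \in sg & l \in lab a.
  move=> /(fintype.subsetP TU)/bigcupP[[a|i] vs].
    by move=> /imsetP[l' l'a [->]]; exists a.
  by rewrite inE.
have cornT i : inr i \in T -> inr i \in sg.
  move=> /(fintype.subsetP TU)/bigcupP[[a|i'] vs]; first by case/imsetP.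
  by rewrite inE => /eqP[->].
have wsum a : \sum_j w a 0 j = 0.
  have [Qr _] := rP a.
  under eq_bigr do rewrite /w mxE [(- r a) _ _]mxE.
  by rewrite sumrB grid_point_sum // Q_sum1 // subrr.
have wb a j : `|w a 0 j| <= grid_side + b.
  rewrite /w mxE [(- r a) _ _]mxE; apply: le_trans (ler_normB _ _) _.
  by have [Qr _] := rP a; rewrite lerD ?Q_bounded ?grid_point_bound.
have no_slack i0 : inr i0 \notin sg.
  apply/negP => i0s; clear cT csg.
  have [_ hr0] := rP a0; have [Qr0 _] := rP a0.
  pose E := K1 * ((g + K1 * g) * (2 * b)).
  have E0 : 0 <= E by rewrite !(mulr_ge0, addr_ge0) // ler0n.
  have wi0 i : inr i \in sg -> w a0 0 i <= -1.
    move=> is_; have ak := (clus a0 i a0s).1 is_.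
    have := Q_bounded Qr0 i; rewrite ler_norml => /andP[rb _].
    have : grid_point a0 0 i <= - (b + 2) + 1.
      rewrite mxE lerD2l; apply: le_trans g1.
      rewrite /g ler_wpM2r ?invr_ge0 ?ler0n // mulrC ler_wpM2r ?ler_nat //.
      exact: ltW.
    move: rb => + hg; rewrite /w mxE [(- r a0) _ _]mxE.
    by move: (r a0 0 i) (grid_point a0 0 i) hg => X Y hX hY; lra.
  have hE l : lam l != 0 -> dotv (w a0) (r a0) - E <= dotv (w a0) (u l).
    move=> ln; have lT : l \in T by apply: contraNT ln => /lamT ->.
    case: l lT ln => [l /labT[a as_ la]|i /cornT is_] ln; last first.
      have wi := wi0 i is_.
      have -> : dotv (w a0) (u (inr i)) = - K * w a0 0 i.
        exact: dotv_corner.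
      have : `|dotv (w a0) (r a0)| <= K1 * ((grid_side + b) * b).
        apply: dotv_le => [|j|j]; rewrite ?wb ?Q_bounded //; lra.
      rewrite ler_norml => /andP[_ hw].
      have : K <= - K * w a0 0 i by nra.
      have : K1 * ((grid_side + b) * b) <= K by rewrite /K; lra.
      lra.
    (* The label [l] is exactly maximal for [w a], and [r a0] is at most maximal for it; exchanging
       [w a] for the nearby [w a0] costs at most [E]. *)
    move: la; rewrite inE => /asboolP[_ hal] /=.
    have [Qra hra] := rP a.
    have h1 := hra _ Qr0; rewrite -/(w a) dotvBr in h1.
    have h2 : `|dotv (w a0 - w a) (u0 l - r a0)| <= E.
      apply: dotv_le => [|j|j].
      - by rewrite addr_ge0 // mulr_ge0 // ler0n.
      - have -> : (w a0 - w a) 0 j = (grid_point a0 0 j - grid_point a 0 j) - (r a0 0 j - r a 0 j).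
          by rewrite /w; move: (grid_point a0) (grid_point a) => X Y; rewrite !mxE; ring.
        by apply: le_trans (ler_normB _ _) _; rewrite lerD ?close ?rclose.
      - rewrite !mxE; apply: le_trans (ler_normB _ _) _.
        by rewrite mulr_natl mulr2n lerD ?Q_bounded.
    move: h2; rewrite ler_norml => /andP[h2 _].
    move: h2; rewrite dotvBl [dotv (w a0) _]dotvBr [dotv (w a) _]dotvBr hal; lra.
  have := slack_bound Qp (fun j => ltW (c0 j)) (kapc i0) (ltW kap0) (rP a0)
    (grid_point_sum a0 N0) (wi0 _ i0s) su lam0 lamE hE.
  have gE : 5 * E <= 2 * kap.
    move: gkap; rewrite ler_pdivlMr; last by rewrite !mulr_gt0 ?ltr0n //; lra.
    rewrite /E => h; apply: le_trans (_ : 2 * (g * (5 * b * K1 * (1 + K1))) <= _); last by lra.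
    by rewrite le_eqVlt; apply/orP; left; apply/eqP; ring.
  move: (\sum_j c 0 j) Sc1 Sc0 => t t1 t0; nra.
have disj : [disjoint sg & slacks (@corner k N)].
  rewrite disjoint_subset; apply/fintype.subsetP => -[a|i] vs; rewrite inE mem_corners //.
  by rewrite (negPf (no_slack i)) in vs.
have rbT := Trb disj.
pose T' := [set l | inl l \in T].
have TE : T = inl @: T'.
  apply/setP => -[l|i]; apply/idP/imsetP.
  - by move=> lT; exists l; rewrite // inE.
  - by case=> l'; rewrite inE => l'T [->].
  - by move/cornT; rewrite (negPf (no_slack i)).
  - by case.
have cT' : #|T'| = k.+1 by have := cT; rewrite csg TE card_imset //; apply: inlI.
pose t (i : 'I_k.+1) : Lb := enum_val (cast_ord (esym cT') i).
have tT i : inl (t i) \in T by have := enum_valP (cast_ord (esym cT') i); rewrite inE.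
have t_inj : injective t by move=> i j /enum_val_inj/cast_ord_inj.
have sumt (V : nmodType) (F : Lb + 'I_k.+1 -> V) : (forall x, x \notin T -> F x = 0) ->
    \sum_x F x = \sum_i F (inl (t i)).
  move=> F0; rewrite (bigID (mem T)) /= [X in _ + X]big1 ?addr0 // TE.
  rewrite big_imset /=; last by move=> x y _ _ [].
  rewrite big_enum_val /= (reindex (cast_ord (esym cT'))) //.
  by exists (cast_ord cT') => i _; rewrite ?cast_ordK ?cast_ordKV.
have [z zP] : exists z : 'I_k.+1 -> vec, forall i,
    exists2 a, inl a \in sg & z i = r a /\ A (t i) (r a).
  apply: (fin_all_exists (P := fun i x =>
    exists2 a, inl a \in sg & x = r a /\ A (t i) (r a))) => i.
  have [a as_] := labT _ (tT i); rewrite inE => /asboolP[Aa _].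
  by exists (r a), a.
have lamS : \sum_x lam x = 1 + \sum_j c 0 j.
  rewrite (coefficient_sum su lamE); under eq_bigr do rewrite mxE.
  by rewrite big_split /= Q_sum1.
have S1 : 0 < 1 + \sum_j c 0 j by rewrite ltr_pwDl.
have lamt : \sum_i lam (inl (t i)) = 1 + \sum_j c 0 j by rewrite -lamS (sumt _ lam).
(* Dividing by the coordinate sum of [p + c] turns the conic combination into a convex one. *)
exists t, z, (fun i => lam (inl (t i)) / (1 + \sum_j c 0 j)); split.
- move=> i i' /= e; apply: t_inj; have := rbT (inl (t i)) (inl (t i')) (tT i) (tT i').
  by rewrite /= e => /(_ erefl) [].
- by move=> i; have [a as_ [-> Aa]] := zP i; have [Qr _] := rP a.
- move=> i i' j; have [a as_ [-> _]] := zP i; have [a' as' [-> _]] := zP i'.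
  by apply: le_trans (rclose a a' j as_ as') _; rewrite mulrC -ler_pdivlMr ?ltr0n.
- split=> [i|]; first by apply: divr_ge0 => //; exact: ltW.
  by rewrite -mulr_suml lamt divff // gt_eqF.
- move=> j.
  have -> : (\sum_i (lam (inl (t i)) / (1 + \sum_j c 0 j)) *: u0 (t i)) 0 j =
      (p + c) 0 j / (1 + \sum_j c 0 j).
    rewrite -lamE (sumt _ (fun x => lam x *: u x)) /=; last first.
      by move=> x /lamT ->; rewrite scale0r.
    rewrite !summxE mulr_suml; apply: eq_bigr => i _.
    by rewrite !mxE mulrAC.
  rewrite mxE; have := Q_bounded Qp j; have := c0 j; have := cs j.
  move: (p 0 j) (c 0 j) (\sum_j c 0 j) ScK Sc0 S1 => pj cj X XK X0 X1 cjs cj0 pb.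
  have -> : (pj + cj) / (1 + X) - pj = (cj - pj * X) / (1 + X) by field; rewrite gt_eqF.
  have X1' : 0 <= (1 + X)^-1 by rewrite invr_ge0 ltW.
  rewrite normrM (ger0_norm X1') ler_pdivrMr //.
  apply: le_trans (ler_normB _ _) _; rewrite normrM (gtr0_norm cj0) (ger0_norm X0).
  exact: err.
Qed.
End Approximation.

(** * Polytopes *)

Local Open Scope classical_set_scope.
Local Open Scope ring_scope.

Section Polytopes.
Variables (R : realType) (d m : nat).
Implicit Types (v : 'I_m -> 'rV[R]_d) (lam : 'rV[R]_m).

Definition hull v : set 'rV[R]_d := [set p | in_conv v p].

Definition simplex : set 'rV[R]_m :=
  [set lam | (forall i, 0 <= lam 0 i) /\ \sum_i lam 0 i = 1].

Lemma hull_simplex v : hull v = (fun lam => \sum_i lam 0 i *: v i) @` simplex.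
Proof.
apply/seteqP; split=> [p [lam [l0 [l1 ->]]]|_ [lam [l0 l1] <-]]; last first.
  by exists (lam 0).
exists (\row_i lam i); first by split=> [i|]; rewrite ?mxE //; under eq_bigr do rewrite mxE.
by apply: eq_bigr => i _; rewrite mxE.
Qed.

Lemma simplex_compact : compact simplex.
Proof.
have -> : simplex = [set lam : 'rV[R]_m | forall i, `[0%R, 1%R]%classic (lam ord0 i)] `&`
    (fun lam : 'rV[R]_m => \sum_i lam 0 i) @^-1` [set x | x = 1].
  apply/seteqP; split=> [lam [l0 l1]|lam [h l1]]; split=> // i /=; last first.
    by have := h i; rewrite /= in_itv /= => /andP[].
  rewrite in_itv /= l0 /= -l1 (bigD1 i) //= lerDl; exact: sumr_ge0.
apply: compact_closedI; first exact: (rV_compact (fun=> @segment_compact R 0 1)).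
apply: preimage_closed; last exact: closed_eq.
move=> x _; apply: continuous_big => [|i _]; first exact: add_continuous.
exact: coord_continuous.
Qed.

Lemma combination_continuous v :
  continuous (fun lam : 'rV[R]_m => \sum_i lam 0 i *: v i).
Proof.
apply: continuous_big => [|i _]; first exact: add_continuous.
move=> x; apply: (@cvgZr_tmp _ _ _ (nbhs x)); exact: coord_continuous.
Qed.

Lemma hull_compact v : compact (hull v).
Proof.
rewrite hull_simplex; apply: continuous_compact; last exact: simplex_compact.
by apply: continuous_subspaceT; apply: combination_continuous.
Qed.

Lemma hull_convex v x y t : hull v x -> hull v y -> 0 <= t <= 1 ->
  hull v (x + t *: (y - x)).
Proof.
move=> [a [a0 [a1 ->]]] [b [b0 [b1 ->]]] /andP[t0 t1].
exists (fun i => a i + t * (b i - a i)); split.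
  move=> i; have := mulr_ge0 t0 (b0 i); have := mulr_ge0 (_ : 0 <= 1 - t) (a0 i).
  rewrite subr_ge0 t1 => /(_ isT); nra.
split; first by rewrite big_split /= -mulr_sumr sumrB a1 b1 subrr mulr0 addr0.
rewrite -sumrB scaler_sumr -big_split; apply: eq_bigr => i _ /=.
by rewrite -scalerBl scalerA -scalerDl.
Qed.

Lemma dotv_sqr_continuous (x : 'rV[R]_d) :
  continuous (fun y : 'rV[R]_d => dotv (x - y) (x - y)).
Proof.
apply: continuous_big => [|j _]; first exact: add_continuous.
have h : continuous (fun y : 'rV[R]_d => (x - y) ord0 j).
  rewrite (_ : (fun y => _) = (fun y : 'rV[R]_d => x ord0 j - y ord0 j)); last first.
    by apply/funext => z; rewrite !mxE.
  move=> y; apply: (@cvgB _ _ _ (nbhs y)); last exact: coord_continuous.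
  exact: (@cvg_cst _ _ _ (nbhs y)).
by move=> y; apply: (@cvgM _ _ (nbhs y)); apply: h.
Qed.

Lemma hull_projection v : hull v !=set0 -> forall x, exists r, is_projection (hull v) x r.
Proof.
move=> v0 x; have [|r rv rmin] :=
    EVT_min_rV (f := fun y => dotv (x - y) (x - y)) v0 (@hull_compact v).
  by apply: continuous_subspaceT; apply: dotv_sqr_continuous.
exists r; split; first by rewrite inE in rv.
move=> y yv; rewrite leNgt; apply/negP => pos.
set a := dotv (x - r) (y - r) in pos; pose c := dotv (y - r) (y - r).
have c0 : 0 <= c by apply: dotv_sqr_ge0.
(* A step [t] towards [y] lowers the squared distance by [t * (2 * a - t * c)], which is positive
   because this choice gives [t * c <= a]. *)
pose t := a / (a + c).
have ac : 0 < a + c by rewrite ltr_wpDr.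
have t0 : 0 < t by rewrite divr_gt0.
have t1 : t <= 1 by rewrite ler_pdivrMr // mul1r lerDl.
have := rmin (r + t *: (y - r)).
rewrite inE => /(_ (hull_convex (set_mem rv) yv _)); rewrite (ltW t0) t1 => /(_ isT).
have -> : dotv (x - (r + t *: (y - r))) (x - (r + t *: (y - r))) =
    dotv (x - r) (x - r) - t * (2 * a - t * c).
  rewrite opprD addrA; rewrite /a /c; move: (x - r) (y - r) => X Y.
  rewrite dotvBl !dotvBr !dotvZr (dotvC (t *: Y)) !dotvZr (dotvC (t *: Y)) dotvZr; ring.
rewrite -[X in X <= _]subr0 lerD2l lerN2 leNgt => /negP; apply.
apply: mulr_gt0 => //; have : t * c <= a; last by lra.
by rewrite /t mulrAC ler_pdivrMr // ler_pM2l // lerDr ltW.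
Qed.

End Polytopes.

(** A cluster point of the sequence of index [i0] is one for every index, since the distances
    between indices tend to zero. *)
Lemma compact_common_point (R : realType) (V : normedModType R) (I : Type)
    (P : set V) (C : I -> set V) (i0 : I) :
  compact P -> (forall i, C i `<=` P) -> (forall i, closed (C i)) ->
  (forall e : R, 0 < e -> exists z : I -> V,
     (forall i, C i (z i)) /\ forall i j, `|z i - z j| <= e) ->
  exists x, forall i, C i x.
Proof.
move=> cP CP Ccl h.
have [z zP] := choice (fun N : nat => h (N.+1%:R^-1) (ltac:(by rewrite invr_gt0))).
have [|x [_ xcl]] := cP ((fun N => z N i0) @ \oo) _.
  by exists 0%N => // N _; apply: (CP i0); apply: (zP N).1.
exists x => i; apply: Ccl => B /nbhs_ballP[e /= e0 eB].
have e2 : 0 < e / 2 by rewrite divr_gt0.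
pose N0 := Num.bound (e / 2)^-1.
have FA : ((fun N => z N i0) @ \oo) [set z N i0 | N in [set N | (N0 <= N)%N]].
  by exists N0 => // N /= N0N; exists N.
have [_ [[N /= N0N <-] hb]] := xcl _ _ FA (nbhsx_ballx x _ e2).
exists (z N i); split; first exact: (zP N).1.
apply: eB; rewrite -ball_normE /= in hb *.
rewrite -[x](subrK (z N i0)) -addrA [e]splitr.
apply: le_lt_trans (ler_normD _ _) _; apply: ltr_leD => //.
apply: le_trans ((zP N).2 i0 i) _.
rewrite -[leRHS]invrK lef_pV2 ?posrE ?invr_gt0 //.
have := archi_boundP (ltW (_ : 0 < (e / 2)^-1)); rewrite invr_gt0 => /(_ e2) /ltW.
by move=> /le_trans; apply; rewrite ler_nat; apply: leq_trans N0N _.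
Qed.

(** * Affine coordinates relative to an independent family *)

Section Coordinates.
Variables (R : realType) (d k : nat).

Lemma dotv_mul (w : 'rV[R]_k) (x : 'rV[R]_d) (G : 'M[R]_(d, k)) :
  dotv w (x *m G) = dotv (w *m G^T) x.
Proof.
have E n (a b : 'rV[R]_n) : dotv a b = (a *m b^T) 0 0.
  by rewrite mxE; apply: eq_bigr => j _; rewrite mxE.
by rewrite !E trmx_mul mulmxA.
Qed.

(** An extra column of ones turns affine into linear independence; the two blocks of a one-sided
    inverse are the linear part and the translation. *)
Lemma affine_coordinates (x : 'I_k.+1 -> 'rV[R]_d) : aff_indep x ->
  exists (G : 'M[R]_(d, k.+1)) (g : 'rV[R]_k.+1), forall lam : 'rV[R]_k.+1,
    \sum_i lam 0 i = 1 -> (\sum_i lam 0 i *: x i) *m G + g = lam.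
Proof.
move=> xi; pose X := \matrix_i x i; pose M := row_mx X (const_mx 1 : 'cV[R]_k.+1).
have lamM (lam : 'rV[R]_k.+1) :
    lam *m M = row_mx (\sum_i lam 0 i *: x i) (\sum_i lam 0 i)%:M.
  rewrite mul_mx_row; congr row_mx.
    by rewrite mulmx_sum_row; apply: eq_bigr => i _; rewrite rowK.
  apply/matrixP => i j; rewrite !ord1 !mxE mulr1n.
  by apply: eq_bigr => l _; rewrite mxE mulr1.
have Mf : row_free M.
  rewrite -kermx_eq0; apply/rowV0P => lam /sub_kermxP.
  rewrite lamM -row_mx0 => /eq_row_mx[l0 /matrixP/(_ 0 0)]; rewrite !mxE mulr1n => l1.
  by apply/rowP => i; rewrite mxE; apply: (xi (fun i => lam 0 i)).
exists (usubmx (pinvmx M)), (dsubmx (pinvmx M)) => lam l1.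
rewrite -[RHS]mulmx1 -(mulmxVp Mf) mulmxA lamM l1 -[X in _ = _ *m X]vsubmxK mul_row_col.
by rewrite mul1mx.
Qed.

(** Adding [p] to the family creates a dependence, in which [p] has a nonzero coefficient because
    the family itself is independent. *)
Lemma aff_dim_span (S : set 'rV[R]_d) (x : 'I_k.+1 -> 'rV[R]_d) :
  aff_indep x -> (forall i, S (x i)) ->
  ~ (exists x : 'I_k.+2 -> 'rV[R]_d, (forall i, S (x i)) /\ aff_indep x) ->
  forall p, S p -> exists lam : 'rV[R]_k.+1, \sum_i lam 0 i = 1 /\
    p = \sum_i lam 0 i *: x i.
Proof.
move=> xi Sx max p Sp; apply: contrapT => np; apply: max.
exists (fun i => if unlift ord0 i is Some j then x j else p); split.
  by move=> i; case: unliftP.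
move=> lam; rewrite big_ord_recl => s0; rewrite big_ord_recl unlift_none.
under [X in _ + X]eq_bigr do rewrite liftK.
move=> c0.
have [l0|ln] := eqVneq (lam ord0) 0.
  rewrite l0 add0r in s0; rewrite l0 scale0r add0r in c0.
  have h := xi (fun i => lam (lift ord0 i)) s0 c0.
  by move=> i; case: (unliftP ord0 i) => [j ->|->].
case: np; exists (\row_i (- (lam ord0)^-1 * lam (lift ord0 i))); split.
  under eq_bigr do rewrite mxE; rewrite -mulr_sumr.
  have -> : \sum_i lam (lift ord0 i) = - lam ord0.
    by apply/eqP; rewrite -addr_eq0 addrC s0.
  by rewrite mulrNN mulVf.
under eq_bigr do rewrite mxE -scalerA; rewrite -scaler_sumr.
have -> : \sum_i lam (lift ord0 i) *: x i = - (lam ord0 *: p).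
  by apply/eqP; rewrite -addr_eq0 addrC c0.
by rewrite scalerN scaleNr opprK scalerA mulVf ?scale1r.
Qed.

End Coordinates.

(** * Faces as sets of generators, and limits of hull points *)

Section Faces.
Variables (R : realType) (d m : nat) (v : 'I_m -> 'rV[R]_d).

(** Encoding faces by sets of generators makes the label type finite. Some [S] encode no face, which
    the labels have to guard against. *)
Definition face_of (S : {set 'I_m}) : set 'rV[R]_d :=
  [set p | exists lam : 'I_m -> R, [/\ forall i, 0 <= lam i,
     forall i, i \notin S -> lam i = 0, \sum_i lam i = 1 &
     p = \sum_i lam i *: v i]].

Lemma hull_vertex i : hull v (v i).
Proof.
exists (fun j => (j == i)%:R); split; first by move=> j; rewrite ler0n.
split; first by rewrite (bigD1 i) //= eqxx big1 ?addr0 // => j /negPf ->.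
by rewrite (bigD1 i) //= eqxx scale1r big1 ?addr0 // => j /negPf ->; rewrite scale0r.
Qed.

Lemma face_face_of (F : set 'rV[R]_d) : is_face (hull v) F -> exists S, F = face_of S.
Proof.
move=> [a [b [ab ->]]]; exists [set i | dotv a (v i) == b]%SET.
have le i : dotv a (v i) <= b by apply: ab; apply: hull_vertex.
apply/seteqP; split=> p; last first.
  move=> [lam [l0 lS l1 pE]]; split; first by exists lam.
  rewrite pE dotv_sumr -[RHS]mul1r -l1 mulr_suml; apply: eq_bigr => i _.
  have [|/lS ->] := boolP (i \in [set i | dotv a (v i) == b]%SET); last by rewrite !mul0r.
  by rewrite inE => /eqP ->.
move=> [[lam [l0 [l1 pE]]] pb]; exists lam; split => // i; rewrite inE => ib.
have s0 : \sum_i lam i * (b - dotv a (v i)) = 0.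
  under eq_bigr do rewrite mulrBr.
  by rewrite sumrB -mulr_suml l1 mul1r -dotv_sumr -pE pb subrr.
have := psumr_eq0P (F := fun i => lam i * (b - dotv a (v i))) _ s0 (i := i) isT.
move=> /(_ _)/eqP; rewrite mulf_eq0 => h.
have /orP[/eqP//|] : (lam i == 0) || (b - dotv a (v i) == 0).
  by apply: h => j _; rewrite mulr_ge0 // subr_ge0.
by rewrite subr_eq0 eq_sym (negPf ib).
Qed.

End Faces.

Lemma subset_of_card (T : finType) (X : {set T}) r : (r <= #|X|)%N ->
  exists2 I : {set T}, I \subset X & #|I| = r.
Proof.
move=> rX; exists [set x in take r (enum X)]%SET.
  by apply/fintype.subsetP => x; rewrite inE => /mem_take; rewrite mem_enum.
rewrite cardsE (card_uniqP _) ?take_uniq ?enum_uniq // size_take -cardE.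
by case: ltngtP rX.
Qed.

(** With [r] the projection of [p], every hull point [q] has [dotv (p - r) (q - r) <= 0]; letting
    [q] tend to [p] forces [p = r]. *)
Lemma approx_hull_closed (R : realType) (d m : nat) (v : 'I_m -> 'rV[R]_d) (p : 'rV[R]_d) :
  (0 < m)%N ->
  (forall e : R, 0 < e -> exists q, hull v q /\ forall j, `|q 0 j - p 0 j| <= e) ->
  hull v p.
Proof.
move=> m0 h; have [|r [vr hr]] := @hull_projection R d m v _ p.
  by exists (v (Ordinal m0)); apply: hull_vertex.
suff -> : p = r by [].
have sq0 : dotv (p - r) (p - r) <= 0.
  rewrite leNgt; apply/negP => pos.
  pose a := \sum_j `|(p - r) 0 j|.
  have a0 : 0 <= a by apply: sumr_ge0.
  have ja j : `|(p - r) 0 j| <= a by rewrite /a (bigD1 j) //= lerDl sumr_ge0.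
  pose e := dotv (p - r) (p - r) / (2 * (d%:R * a + 1)).
  have da : 0 <= d%:R * a by rewrite mulr_ge0 // ler0n.
  have e0 : 0 < e by rewrite divr_gt0 //; lra.
  have [q [vq qe]] := h e e0.
  have := hr q vq; have : `|dotv (p - r) (p - q)| <= d%:R * (a * e).
    by apply: dotv_le => // j; rewrite mxE [(- q) _ _]mxE distrC.
  rewrite ler_norml => /andP[_ h1] h2.
  have E : dotv (p - r) (p - r) = dotv (p - r) (p - q) + dotv (p - r) (q - r).
    by rewrite -dotvDr addrA subrK.
  have : dotv (p - r) (p - r) = e * (2 * (d%:R * a + 1)) by rewrite divfK // gt_eqF //; lra.
  nra.
apply/rowP => j; apply/eqP; rewrite -subr_eq0; apply/eqP.
have : \sum_j (p - r) 0 j * (p - r) 0 j = 0.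
  by apply/eqP; rewrite eq_le sq0 dotv_sqr_ge0.
move/psumr_eq0P => /(_ (fun j _ => _))/(_ j isT) hj.
have /eqP := hj (fun j => ltac:(by rewrite -expr2 sqr_ge0)).
by rewrite mulf_eq0 orbb => /eqP; rewrite mxE [(- r) _ _]mxE.
Qed.

(** * The theorem *)

(** This frees the choice of labels from the precision. If each [t] failed at some [eT t], all would
    fail at [(1 + s)^-1], which lies below every [eT t]. *)
Lemma finite_choice_uniform (R : realType) (T : finType) (good : T -> R -> Prop) :
  (forall t e e', e <= e' -> good t e -> good t e') ->
  (forall e, 0 < e -> exists t, good t e) ->
  exists t, forall e, 0 < e -> good t e.
Proof.
move=> mono h; apply: contrapT => nt.
have /choice[eT eTP] : forall t, exists e, 0 < e /\ ~ good t e.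
  move=> t; apply: contrapT => ne; apply: nt; exists t => e e0.
  by apply: contrapT => ng; apply: ne; exists e.
pose s := \sum_t (eT t)^-1.
have s0 : 0 <= s by apply: sumr_ge0 => t _; rewrite invr_ge0 ltW // (eTP t).1.
have [|t gt] := h (1 + s)^-1; first by rewrite invr_gt0 ltr_pwDl.
apply: (eTP t).2; apply: mono gt; rewrite invf_ple ?posrE ?(eTP t).1 ?ltr_pwDl //.
rewrite /s (bigD1 t) //= addrCA lerDl addr_ge0 // sumr_ge0 // => i _.
by rewrite invr_ge0 ltW // (eTP i).1.
Qed.

Theorem theorem1p5 (R : realType) (d n k : nat)
  (P : set 'rV[R]_d) (p : 'rV[R]_d)
  (y : set 'rV[R]_d -> 'I_n -> 'rV[R]_d)
  (A : 'I_n -> set 'rV[R]_d -> set 'rV[R]_d) :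
  (2 <= k)%N -> (k <= n)%N ->
  is_polytope P -> aff_dim_eq P k.-1 -> P p ->
  (forall tau, FP P tau -> forall i, tau (y tau i)) ->
  (forall i tau, FP P tau -> A i tau `<=` P /\ closed (A i tau)) ->
  (forall (I : {set 'I_n}), #|I| = (n - k + 1)%N ->
     forall sigma, is_face P sigma ->
       sigma `<=` \bigcup_(tau in [set t | FP P t /\ t `<=` sigma])
                     \bigcup_(j in [set j | j \in I]) A j tau) ->
  exists (pi : 'I_k -> 'I_n) (tau : 'I_k -> set 'rV[R]_d),
    injective pi /\ (forall i, FP P (tau i)) /\
    in_conv (fun i => y (tau i) (pi i)) p /\
    (\bigcap_(i in [set: 'I_k]) A (pi i) (tau i)) !=set0.
Proof.
(* From here on [k] is the dimension of [P], and [k.+1] colours are sought. *)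
case: k => // k k2 kn [m [v PE]]; rewrite -[k.+1.-1]/k => -[[x [xP xi]] max] Pp yP AP cov.
have {}PE : P = hull v by [].
have span := aff_dim_span xi xP max.
have [G [g cg]] := affine_coordinates xi.
pose base (lam : 'rV[R]_k.+1) : 'rV[R]_d := \sum_i lam 0 i *: x i.
pose coords (q : 'rV[R]_d) : 'rV[R]_k.+1 := q *m G + g.
have cb (lam : 'rV[R]_k.+1) : \sum_i lam 0 i = 1 -> coords (base lam) = lam by exact: cg.
have bc q : P q -> base (coords q) = q.
  by move=> /span[lam [l1 ->]]; rewrite -/(base lam) cb.
have cs1 q : P q -> \sum_i coords q 0 i = 1.
  by move=> /span[lam [l1 ->]]; rewrite -/(base lam) cb.
have coords_comb (I : finType) (c : I -> R) (q : I -> 'rV[R]_d) : \sum_i c i = 1 ->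
    coords (\sum_i c i *: q i) = \sum_i c i *: coords (q i).
  move=> c1; rewrite /coords mulmx_suml -[X in _ + X]scale1r -c1 scaler_suml -big_split.
  by apply: eq_bigr => i _ /=; rewrite scalerDr scalemxAl.
have base_comb (I : finType) (c : I -> R) (q : I -> 'rV[R]_k.+1) :
    base (\sum_i c i *: q i) = \sum_i c i *: base (q i).
  rewrite /base; under eq_bigr do rewrite summxE scaler_suml.
  rewrite exchange_big; apply: eq_bigr => i _ /=; rewrite scaler_sumr.
  by apply: eq_bigr => j _; rewrite mxE scalerA.
have vP i : P (v i) by rewrite PE; apply: hull_vertex.
pose Q := hull (fun i => coords (v i)).
have Qc q : P q -> Q (coords q).
  by rewrite PE => -[lam [l0 [l1 ->]]]; exists lam; rewrite coords_comb.
have Qb q : Q q -> P (base q) /\ coords (base q) = q.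
  move=> [lam [l0 [l1 ->]]]; rewrite -coords_comb //.
  have Pq : P (\sum_i lam i *: v i) by rewrite PE; exists lam.
  by rewrite bc.
have Q1 q : Q q -> \sum_j q 0 j = 1 by move=> /Qb[Pq e]; rewrite -e cs1.
have Qdelta i : Q (delta_mx 0 i).
  rewrite -[delta_mx 0 i]cb; last first.
    by rewrite (bigD1 i) //= mxE !eqxx big1 ?addr0 // => j /negPf ji; rewrite mxE ji andbF.
  apply: Qc; rewrite /base (bigD1 i) //= mxE !eqxx scale1r big1 ?addr0 //.
  by move=> j /negPf ji; rewrite mxE ji andbF scale0r.
pose b : R := 1 + \sum_i \sum_j `|coords (v i) 0 j|.
have b1 : 1 <= b by rewrite lerDl sumr_ge0 // => i _; apply: sumr_ge0.
have Qbound q : Q q -> forall j, `|q 0 j| <= b.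
  move=> [lam [l0 [l1 ->]]] j; rewrite summxE.
  apply: le_trans (ler_norm_sum _ _ _) _.
  apply: le_trans (_ : \sum_i \sum_j `|coords (v i) 0 j| <= _); last by rewrite lerDr.
  apply: ler_sum => i _; rewrite mxE normrM (ger0_norm (l0 i)).
  apply: le_trans (_ : `|coords (v i) 0 j| <= _).
    by rewrite ler_piMl // -l1 (bigD1 i) //= lerDl sumr_ge0.
  by rewrite (bigD1 j) //= lerDl sumr_ge0.
have Qproj q : exists r, is_projection Q q r.
  by apply: hull_projection; exists (coords p); apply: Qc.
pose Lb := ({set 'I_m} * 'I_n)%type.
pose fc (l : Lb) := face_of v l.1.
(* The default [coords p] only keeps [u0] inside [Q]; [A'] is empty for labels that encode no proper
   face. *)
pose u0 (l : Lb) := if `[< FP P (fc l) >] then coords (y (fc l) l.2) else coords p.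
pose A' (l : Lb) (q : 'rV[R]_k.+1) := FP P (fc l) /\ A l.2 (fc l) (base q).
have faceP F : is_face P F -> F `<=` P by move=> [a [c [_ ->]]] q [].
have Qu l : Q (u0 l).
  rewrite /u0; case: asboolP => [Fl|_]; apply: Qc => //.
  by apply: (faceP _ Fl.1); apply: yP.
have Qcover w r : Q r -> (forall q, Q q -> dotv w q <= dotv w r) ->
    (k < #|snd @: [set l : Lb | `[< A' l r /\ dotv w (u0 l) = dotv w r >]]%SET|)%N.
  move=> Qr wr; rewrite ltnNge; apply/negP; set X := imset _ _ => Xk.
  (* With at most [k] colours present, [n - k] remain, just enough for the covering hypothesis.
     Applied to the face exposed by [w], it yields a label of a colour outside [X]. *)
  have [I IX cI] : exists2 I : {set 'I_n}, I \subset ~: X & #|I| = (n - k.+1 + 1)%N.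
    apply: subset_of_card; rewrite cardsCs finset.setCK card_ord; move: #|X| Xk => c Xk; lia.
  have [Pr rE] := Qb r Qr.
  have dE q : dotv w (coords q) = dotv (w *m G^T) q + dotv w g.
    by rewrite dotvDr dotv_mul.
  pose sg := [set q | P q /\ dotv (w *m G^T) q = dotv w r - dotv w g].
  have sgF : is_face P sg.
    exists (w *m G^T), (dotv w r - dotv w g); split => // q Pq.
    by rewrite lerBrDr -dE wr //; apply: Qc.
  have rs : sg (base r) by split => //; rewrite -[in RHS]rE dE addrK.
  have [tau [Ft ts] [j jI Aj]] := cov I cI sg sgF _ rs.
  have [S tE] : exists S, tau = face_of v S by apply: face_face_of; rewrite -PE; apply: Ft.1.
  have : j \in X.
    apply/imsetP; exists (S, j) => //; rewrite inE; apply/asboolP; split.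
      by split; rewrite /fc /= -tE.
    rewrite /u0 /fc /= -tE asboolT //.
    have [_] := ts _ (yP _ Ft j); rewrite dE => ->; by rewrite subrK.
  by have := fintype.subsetP IX j jI; rewrite inE => /negP.
have approx := @approximate_rainbow R k Q b b1 Qbound Q1 Qdelta Lb 'I_n u0 snd A'
  k2 Qu Qproj Qcover (coords p).
pose good (T : {ffun 'I_k.+1 -> Lb}) (e : R) :=
  exists (z : 'I_k.+1 -> 'rV[R]_k.+1) (mu : 'I_k.+1 -> R),
  [/\ injective (snd \o T),
      forall i, Q (z i) /\ A' (T i) (z i),
      forall i i' j, `|z i 0 j - z i' 0 j| <= e,
      (forall i, 0 <= mu i) /\ \sum_i mu i = 1 &
      forall j, `|(\sum_i mu i *: u0 (T i)) 0 j - coords p 0 j| <= e].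
have [T goodT] : exists T, forall e, 0 < e -> good T e.
  apply: finite_choice_uniform => [T e e' ee [z [mu [h1 h2 h3 h4 h5]]]|e e0].
    exists z, mu; split => // [i i' j|j]; first exact: le_trans ee.
    exact: le_trans ee.
  have [T [z [mu [h1 h2 h3 h4 h5]]]] := approx e (Qc p Pp) e0.
  have TE : [ffun i => T i] =1 T by move=> i; rewrite ffunE.
  exists [ffun i => T i], z, mu; split => // [i i' /=|i|j]; rewrite ?TE //.
    by move=> e'; apply: h1.
  by under eq_bigr do rewrite TE.
have [z1 [nu1 [Tinj TA _ _ _]]] := goodT 1 ltr01.
have FT i : FP P (fc (T i)) by have [_ []] := TA i.
have uE i : u0 (T i) = coords (y (fc (T i)) (T i).2) by rewrite /u0 asboolT.
have yPi i : P (y (fc (T i)) (T i).2) by apply: (faceP _ (FT i).1); apply: yP.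
exists (fun i => (T i).2), (fun i => fc (T i)); split; first exact: Tinj.
split; first exact: FT.
split.
  have [|mu [mu0 [mu1 pE]]] := @approx_hull_closed R _ _ (fun i => u0 (T i)) (coords p) isT.
    move=> e /goodT[z [mu [_ _ _ [mu0 mu1] h]]].
    by exists (\sum_i mu i *: u0 (T i)); split => //; exists mu.
  exists mu; split => //; split => //.
  rewrite -[p]bc // pE base_comb; apply: eq_bigr => i _.
  by rewrite uE bc.
have [||||q qP] := @compact_common_point R 'rV[R]_d 'I_k.+1 P (fun i => A (T i).2 (fc (T i))) ord0.
- by rewrite PE; apply: hull_compact.
- by move=> i; exact: (AP _ _ (FT i)).1.
- by move=> i; exact: (AP _ _ (FT i)).2.
(* [c] is a Lipschitz constant of [base], from coordinatewise distance to the norm. *)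
- move=> e e0; pose c := \sum_i `|x i|.
  have c0 : 0 <= c by apply: sumr_ge0.
  have [|z [mu [_ zP zc _ _]]] := goodT (e / (1 + c)); first by rewrite divr_gt0 // ltr_pwDl.
  exists (base \o z); split=> [i|i j]; first by have [_ []] := zP i.
  rewrite /= /base -sumrB; apply: le_trans (ler_norm_sum _ _ _) _.
  apply: le_trans (_ : \sum_l e / (1 + c) * `|x l| <= _).
    by apply: ler_sum => l _; rewrite -scalerBl normrZ ler_wpM2r.
  rewrite -mulr_sumr -/c mulrAC ler_pdivrMr ?ltr_pwDl // ler_wpM2l ?ltW //.
  by rewrite ltrDr.
by exists q => i _; apply: qP.
Qed.
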